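(* Fix a real $s>0$. (1) There is an absolute constant $c_1>0$ such that for all sufficiently large $N$ and all $\delta$ with $c_1/N\le\delta\le1$, $$I^\flat_{s,2}(\delta;N)\gg\delta^2N^{s-1}\max\{1,(\delta N)^{s-2}\}.$$ (2) There is an absolute constant $c_2>0$ such that for all sufficiently large $N$ and all $\delta$ with $c_2/\sqrt N\le\delta\le1$, $$I^\flat_{s,2}(\delta;N)\gg\delta^2N^{3(s-1)/2}.$$ The implied constants depend only on $s$.
   Context: For integers $N\ge1$ and $\mathbf x=(x_1,x_2)\in\mathsf T_2=[0,1)^2$ (identified with $(\mathbb R/\mathbb Z)^2$), let $S_2(\mathbf x;N)=\sum_{n=1}^N\exp\bigl(2\pi i(x_1n+x_2n^2)\bigr)$. For real $s>0$, $\delta\in(0,1]$ and $\boldsymbol\xi\in\mathsf T_2$, let $I_{s,2}(\delta,\boldsymbol\xi;N)=\int_{\boldsymbol\xi+[0,\delta]^2}|S_2(\mathbf x;N)|^{2s}d\mathbf x$ (the integrand is 1-periodic in each coordinate), and $I^\flat_{s,2}(\delta;N)=\inf_{\boldsymbol\xi\in\mathsf T_2}I_{s,2}(\delta,\boldsymbol\xi;N)$. $X\gg Y$ means $X\ge cY$ for some constant $c>0$. *)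

(* Defs.v *)
From HB Require Import structures.
From mathcomp Require Import all_boot all_order all_algebra.
From mathcomp Require Import complex.
From mathcomp Require Import all_classical all_reals all_analysis.

Set Implicit Arguments.
Unset Strict Implicit.
Unset Printing Implicit Defensive.

Import Order.TTheory GRing.Theory Num.Theory.
Import numFieldNormedType.Exports.

Local Open Scope classical_set_scope.
Local Open Scope ring_scope.

(* exp(2 pi i t), for real t *)
Definition expi (R : realType) (t : R) : R[i] :=
  Complex (cos (2 * pi * t)) (sin (2 * pi * t)).

Definition S2 (R : realType) (x : R * R) (N : nat) : R[i] :=
  \sum_(1 <= n < N.+1) expi (x.1 * n%:R + x.2 * n%:R ^+ 2).

(* The modulus |z| of a complex number, as a real number; the norm `|z| of
   R[i] is its image in R[i]. *)
Notation modulus := ComplexField.Normc.normc.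

Definition T2 (R : realType) : set (R * R) := `[0, 1[ `*` `[0, 1[.

(* xi + [0, delta]^2, as a subset of the plane: the integrand below is defined
   on the whole plane and 1-periodic, so no reduction modulo 1 is needed. *)
Definition box (R : realType) (delta : R) (xi : R * R) : set (R * R) :=
  `[xi.1, xi.1 + delta] `*` `[xi.2, xi.2 + delta].

Definition I2 (R : realType) (s delta : R) (xi : R * R) (N : nat) : \bar R :=
  (\int[(@lebesgue_measure R \x @lebesgue_measure R)%E]_(x in box delta xi)
     (modulus (S2 x N) `^ (2 * s))%:E)%E.

Definition I2flat (R : realType) (s delta : R) (N : nat) : \bar R :=
  ereal_inf [set I2 s delta xi N | xi in @T2 R].

(* Main.v *)
(* Near a rational point (a1/q, a2/q) with a2 prime to q the sum S2 is large: over a period it is a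
   quadratic Gauss sum of modulus at least sqrt q, so |S2| is of size N / sqrt q as soon as the
   incomplete sums are smaller than that, and Abel summation propagates this to a rectangle of
   sides about 1/N and 1/N^2.

   Part (2) uses all reduced fractions a2/q in the x2-side with q ~ sqrt N, where incomplete sums
   are bounded trivially by q.  There are >> delta N of them: by Dirichlet's theorem the arcs of
   radius 1/(qQ) cover the side, and those with q <= Q/8 cover only a fraction of it because their
   enlargements by a factor 4 are disjoint.

   In part (1), the term max = 1, and more generally every delta with (delta N)^(s-2) <= N, follows
   from a mean square bound: for each fixed x1, smoothing in x2 leaves only the diagonal, because
   n^2 - m^2 is of size at least N |n - m| / 2 unless n and m are both at most N/2.  Otherwise
   delta >= N^(eta-1) for some eta = eta(s) > 0, and a single point with denominator
   q = 3^k ~ 1/delta suffices: q is below N^(1-eta) up to a constant, so the bound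
   sqrt q (5 + 4 ln q) obtained by completing the incomplete sums is good enough. *)
Require Import Defs.
From HB Require Import structures.
From mathcomp Require Import all_boot all_order all_algebra.
From mathcomp Require Import complex.
From mathcomp Require Import all_classical all_reals all_analysis.
From mathcomp Require Import measurable_realfun.
From mathcomp Require Import ring lra zify.

Set Implicit Arguments.
Unset Strict Implicit.
Unset Printing Implicit Defensive.

Import Order.TTheory GRing.Theory Num.Theory.
Import numFieldNormedType.Exports.
Import ComplexField.Normc.

Local Open Scope classical_set_scope.
Local Open Scope ring_scope.

(** * The modulus and the exponential *)

Lemma normc_ge0 (R : realType) (z : R[i]) : 0 <= normc z.
Proof. by case: z => a b /=; exact: sqrtr_ge0. Qed.

Lemma normcD (R : realType) (x y : R[i]) : normc (x + y) <= normc x + normc y.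
Proof. exact: (@le_normcD R x y). Qed.

Lemma normc_opp (R : realType) (x : R[i]) : normc (- x) = normc x.
Proof. exact: (@normcN R x). Qed.

Lemma normcB (R : realType) (x y : R[i]) : normc (x - y) <= normc x + normc y.
Proof. by rewrite -(normc_opp y); exact: normcD. Qed.

Lemma normcB_ge (R : realType) (x y : R[i]) : normc x - normc y <= normc (x - y).
Proof. by rewrite lerBlDr; have := normcD (x - y) y; rewrite subrK. Qed.

Lemma normc_sum (R : realType) (I : Type) (r : seq I) (P : pred I) (F : I -> R[i]) :
  normc (\sum_(i <- r | P i) F i) <= \sum_(i <- r | P i) normc (F i).
Proof.
elim/big_rec2: _ => [|i x y _ le_yx]; first by rewrite normc0.
by apply: (le_trans (normcD _ _)); rewrite lerD2l.
Qed.

Lemma normc_nat (R : realType) n : normc (n%:R : R[i]) = n%:R.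
Proof.
by rewrite -(rmorph_nat (real_complex R)) /= expr0n addr0 sqrtr_sqr ger0_norm.
Qed.

Lemma normc_conj (R : realType) (z : R[i]) : normc (conjc z) = normc z.
Proof. by case: z => a b /=; rewrite sqrrN. Qed.

Lemma mulc_conj (R : realType) (z : R[i]) : z * conjc z = (normc z ^+ 2)%:C%C.
Proof.
case: z => a b; rewrite /= sqr_sqrtr ?addr_ge0 ?sqr_ge0 //; simpc.
by rewrite [b * a]mulrC addNr -!expr2.
Qed.

Lemma expiD (R : realType) (t u : R) : expi (t + u) = expi t * expi u.
Proof. by rewrite /expi mulrDr cosD sinD; simpc; rewrite [X in Complex _ X]addrC. Qed.

Lemma expi0 (R : realType) : expi (0 : R) = 1.
Proof. by rewrite /expi mulr0 cos0 sin0. Qed.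

Lemma normc_expi (R : realType) (t : R) : normc (expi t) = 1.
Proof. by rewrite /= cos2Dsin2 sqrtr1. Qed.

Lemma expi_nat (R : realType) n : expi (n%:R : R) = 1.
Proof.
elim: n => [|n IH]; first exact: expi0.
rewrite -addn1 natrD expiD IH mul1r /expi mulr1.
by rewrite mulr_natl cos2pi sin2pi.
Qed.

Lemma normc_expi_sub1 (R : realType) (t : R) :
  normc (expi t - 1) = 2 * `|sin (pi * t)|.
Proof.
have -> : expi t - 1 = Complex (cos (2 * pi * t) - 1) (sin (2 * pi * t)).
  by rewrite /expi; simpc.
rewrite /=.
have -> : 2 * pi * t = (pi * t) *+ 2 by rewrite mulr2n; ring.
have h := cos2sin2 (pi * t : R).
rewrite cos_mulr2n sin_mulr2n.
have -> : (cos (pi * t) ^+ 2 *+ 2 - 1 - 1) ^+ 2 + (cos (pi * t) * sin (pi * t) *+ 2) ^+ 2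
   = (2 * sin (pi * t)) ^+ 2 by ring: h.
by rewrite sqrtr_sqr normrM ger0_norm.
Qed.

Lemma pi_lt4 (R : realType) : pi < 4 :> R.
Proof. by have := @pihalf_lt2 R; lra. Qed.

Lemma sin_le (R : realType) (x : R) : 0 <= x -> sin x <= x.
Proof.
rewrite le_eqVlt => /predU1P[<-|x0]; first by rewrite sin0.
have [c _] := @MVT R sin cos 0 x x0 (fun y _ => is_derive_sin y)
  (continuous_subspaceT (@continuous_sin R)).
rewrite sin0 !subr0 => ->.
by rewrite -[leRHS]mul1r ler_wpM2r ?(ltW x0) // cos_le1.
Qed.

Lemma norm_sin_le (R : realType) (x : R) : `|sin x| <= `|x|.
Proof.
wlog x0 : x / 0 <= x.
  by move=> H; have [/H//|/ltW] := leP 0 x; rewrite -oppr_ge0 => /H; rewrite sinN !normrN.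
have [x1|x1] := leP x 1.
  rewrite ger0_norm ?(ger0_norm x0) ?sin_le // sin_ge0_pi // x0 /=.
  by rewrite (le_trans x1) // (le_trans _ (@pi_ge2 R)) // ler1n.
by rewrite (le_trans (sin_max _)) // ger0_norm // ltW.
Qed.

Lemma normc_expi_sub1_le (R : realType) (t : R) : normc (expi t - 1) <= 8 * `|t|.
Proof.
rewrite normc_expi_sub1; have := norm_sin_le (pi * t).
rewrite normrM (ger0_norm (pi_ge0 R)) => h.
have := normr_ge0 t; have := pi_lt4 R; nra.
Qed.

(** The left side is [2 * sin (pi * t)], and concavity of the sine would give the constant 4. The
    constant 1 suffices here and needs only that sin and cos of pi/4 are at least 1/2. *)
Lemma normc_expi_sub1_ge (R : realType) (t : R) :
  0 <= t -> t <= 2^-1 -> t <= normc (expi t - 1).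
Proof.
rewrite le_eqVlt => /predU1P[<- _|t0 th]; first exact: normc_ge0.
rewrite normc_expi_sub1.
have p2 := @pi_ge2 R; have p4 := pi_lt4 R.
have s2 : sin (pi / 4) ^+ 2 = 2^-1 :> R.
  have := cos_mulr2n (pi / 4 : R).
  have -> : (pi / 4 : R) *+ 2 = pi / 2 by rewrite mulr2n; field.
  rewrite cos_pihalf => h; have := cos2Dsin2 (pi / 4 : R); lra.
have sp : 0 <= sin (pi / 4) :> R by apply: sin_ge0_pi; lra.
have cp : cos (pi / 4) ^+ 2 = 2^-1 :> R by have := cos2Dsin2 (pi / 4 : R); lra.
have cp0 : 0 <= cos (pi / 4) :> R by apply: cos_ge0_pihalf; lra.
have ch : 2^-1 <= cos (pi / 4) :> R by rewrite leNgt; apply/negP => ?; nra.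
have sh : 2^-1 <= sin (pi / 4) :> R by rewrite leNgt; apply/negP => ?; nra.
apply: (@le_trans _ _ (2 * sin (pi * t))); last by rewrite ler_wpM2l // ler_norm.
(* Up to 1/4 the mean value theorem applies with derivative at least cos(pi/4); beyond 1/4 the sine
   is at least sin(pi/4). *)
have [tq|tq] := leP t 4^-1.
  have x0 : 0 < pi * t by rewrite mulr_gt0 // pi_gt0.
  have [c] := @MVT R sin cos 0 (pi * t) x0 (fun y _ => is_derive_sin y)
    (continuous_subspaceT (@continuous_sin R)).
  rewrite in_itv /= sin0 !subr0 => /andP[c0 c1] ->.
  suff cc : cos (pi / 4) <= cos c.
    have : 2 * (cos c * (pi * t)) - t = (2 * pi * cos c - 1) * t by ring.
    suff : 1 <= 2 * pi * cos c by nra.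
    nra.
  by rewrite leNgt ltr_cos ?in_itv /= -?leNgt; nra.
have st : sin (pi / 4) <= sin (pi * t).
  by rewrite leNgt ltr_sin ?in_itv /= -?leNgt; nra.
lra.
Qed.

(** * Quadratic Gauss sums *)

(** The additive character mod q. Its argument is a natural number, so negative frequencies appear
    below as [q - k] or [(q - 1) * k]. *)
Definition rexp (R : realType) (q k : nat) : R[i] := expi (k%:R / q%:R : R).

Lemma rexpD (R : realType) (q k l : nat) : rexp R q (k + l) = rexp R q k * rexp R q l.
Proof. by rewrite /rexp natrD mulrDl expiD. Qed.

Lemma rexp0 (R : realType) (q : nat) : rexp R q 0 = 1.
Proof. by rewrite /rexp mul0r expi0. Qed.

Lemma rexpX (R : realType) (q k n : nat) : rexp R q (k * n) = rexp R q k ^+ n.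
Proof.
by elim: n => [|n IH]; rewrite ?muln0 ?rexp0 ?expr0 // mulnS rexpD IH exprS.
Qed.

Lemma normc_rexp (R : realType) (q k : nat) : normc (rexp R q k) = 1.
Proof. exact: normc_expi. Qed.

Lemma rexp_conj (R : realType) (q k : nat) : rexp R q k * conjc (rexp R q k) = 1.
Proof. by rewrite mulc_conj normc_rexp expr1n. Qed.

Lemma rexp_dvd (R : realType) (q k : nat) : (0 < q)%N -> (q %| k)%N -> rexp R q k = 1.
Proof.
move=> q0 /dvdnP[j ->].
by rewrite /rexp natrM mulfK ?pnatr_eq0 -?lt0n // expi_nat.
Qed.

Lemma rexp_modn (R : realType) (q k l : nat) :
  (0 < q)%N -> k = l %[mod q] -> rexp R q k = rexp R q l.
Proof.
move=> q0 kl; rewrite (divn_eq k q) (divn_eq l q) !rexpD kl.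
by rewrite !(@rexp_dvd R q (_ * q)) ?dvdn_mull.
Qed.

(** The left side is the distance from k/q to the nearest integer. For k beyond q/2, conjugation
    replaces k by q - k. *)
Lemma rexp_sub1_ge (R : realType) (q k : nat) : (0 < k < q)%N ->
  (minn k (q - k))%:R / q%:R <= normc (rexp R q k - 1).
Proof.
move=> /andP[k0 kq]; have q0 : 0 < q%:R :> R by rewrite ltr0n (ltn_trans k0).
have [h|h] := leqP k (q - k).
  apply: normc_expi_sub1_ge; first by rewrite divr_ge0 ?ler0n.
  rewrite ler_pdivrMr // mulrC ler_pdivlMr // -natrM ler_nat; lia.
have -> : normc (rexp R q k - 1) = normc (rexp R q (q - k) - 1).
  rewrite -normc_conj; congr normc.
  have e : rexp R q (q - k) = conjc (rexp R q k).
    rewrite -[LHS]mulr1 -(@rexp_conj R q k) mulrA -rexpD subnK ?(ltnW kq) //.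
    by rewrite rexp_dvd ?(ltn_trans k0) // mul1r.
  by rewrite e rmorphB rmorph1.
apply: normc_expi_sub1_ge; first by rewrite divr_ge0 ?ler0n.
rewrite ler_pdivrMr // mulrC ler_pdivlMr // -natrM ler_nat; lia.
Qed.

Lemma rexp_neq1 (R : realType) (q k : nat) :
  (0 < q)%N -> ~~ (q %| k)%N -> rexp R q k != 1.
Proof.
move=> q0 qk; rewrite -(@rexp_modn R q (k %% q)) ?modn_mod // -subr_eq0.
have k0 : (0 < k %% q < q)%N by rewrite ltn_mod q0 lt0n andbT.
apply: contraTneq (rexp_sub1_ge R k0) => ->.
rewrite normc0 -ltNge divr_gt0 ?ltr0n //.
by rewrite leq_min; move: k0; lia.
Qed.

Lemma sum_rexp (R : realType) (q k : nat) : (0 < q)%N ->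
  \sum_(n < q) rexp R q (k * n) = if (q %| k)%N then q%:R else 0.
Proof.
move=> q0; case: ifPn => [qk|qk].
  rewrite (eq_bigr (fun=> 1)); last by move=> i _; rewrite rexp_dvd // dvdn_mulr.
  by rewrite sumr_const card_ord.
under eq_bigr do rewrite rexpX.
apply/eqP; have := subrX1 (rexp R q k) q.
rewrite -rexpX rexp_dvd ?dvdn_mull // subrr => /esym/eqP.
by rewrite mulf_eq0 subr_eq0 (negPf (rexp_neq1 _ q0 qk)).
Qed.

(** A geometric sum: the numerator has modulus at most 2, and [rexp_sub1_ge] bounds the denominator
    from below. *)
Lemma sum_rexp_partial_le (R : realType) (q k r : nat) : (0 < k < q)%N ->
  normc (\sum_(n < r) rexp R q (k * n)) <= 2 * q%:R / (minn k (q - k))%:R.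
Proof.
move=> kq; have m0 : 0 < (minn k (q - k))%:R :> R.
  by rewrite ltr0n leq_min; move: kq; lia.
have q0 : 0 < q%:R :> R by rewrite ltr0n; move: kq; lia.
under eq_bigr do rewrite rexpX.
have := subrX1 (rexp R q k) r => /(congr1 (@normc R)); rewrite normcM.
set S := normc (\sum_(i < r) _) => h.
have : normc (rexp R q k ^+ r - 1) <= 2.
  by apply: le_trans (normcB _ _) _; rewrite -rexpX normc_rexp normc1.
have S0 : 0 <= S by exact: normc_ge0.
rewrite h => h2; rewrite ler_pdivlMr //.
have := rexp_sub1_ge R kq; rewrite ler_pdivrMr // => h3.
have := ler_wpM2l S0 h3; nra.
Qed.

Lemma sum_periodic_shift (V : zmodType) (q n : nat) (F : nat -> V) :
  (forall k, F (k + q)%N = F k) -> \sum_(h < q) F (n + h)%N = \sum_(h < q) F h.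
Proof.
move=> Fq; elim: n => [//|n IH]; rewrite -{}IH.
case: q Fq => [|q] Fq; first by rewrite !big_ord0.
rewrite big_ord_recr big_ord_recl /= addrC; congr (_ + _).
  by rewrite addSnnS Fq addn0.
by apply: eq_bigr => i _; rewrite /bump addSnnS.
Qed.

Lemma sum_periodic_split (V : zmodType) (q n : nat) (F : nat -> V) : (0 < q)%N ->
  (forall k, F (k + q)%N = F k) ->
  \sum_(h < n) F h = (\sum_(h < q) F h) *+ (n %/ q)%N + \sum_(h < (n %% q)%N) F h.
Proof.
move=> q0 Fq; have Fqj j k : F (j * q + k)%N = F k.
  by elim: j => [//|j IH]; rewrite mulSnr addnAC Fq.
transitivity (\sum_(h < (n %/ q * q + n %% q)%N) F h); first by rewrite -divn_eq.
rewrite big_split_ord /=; congr (_ + _); last first.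
  by apply: eq_bigr => i _; rewrite Fqj.
elim: (n %/ q)%N => [|j IH]; first by rewrite big_ord0.
rewrite mulSnr big_split_ord /= IH mulrSr; congr (_ + _).
by apply: eq_bigr => i _; rewrite Fqj.
Qed.

Definition gauss_phase (R : realType) (q a1 a2 n : nat) : R[i] :=
  rexp R q (a1 * n + a2 * n ^ 2).

Definition gauss_sum (R : realType) (q a1 a2 : nat) : R[i] :=
  \sum_(n < q) gauss_phase R q a1 a2 n.

Lemma gauss_phase_periodic (R : realType) (q a1 a2 : nat) : (0 < q)%N ->
  forall n, gauss_phase R q a1 a2 (n + q) = gauss_phase R q a1 a2 n.
Proof.
move=> q0 n; apply: rexp_modn => //.
have -> : (a1 * (n + q) + a2 * (n + q) ^ 2 =
  (a1 + a2 * (2 * n + q)) * q + (a1 * n + a2 * n ^ 2))%N by ring.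
by rewrite modnMDl.
Qed.

(** Weyl differencing: after shifting one variable by the other, the phase difference is linear in n
    with frequency 2 a2 h, so orthogonality kills every h with q not dividing 2 a2 h. *)
Lemma gauss_sum_sqr (R : realType) (q a1 a2 : nat) : (0 < q)%N ->
  ((normc (gauss_sum R q a1 a2) ^+ 2)%:C)%C =
  q%:R * \sum_(h < q | (q %| 2 * a2 * h)%N) gauss_phase R q a1 a2 h.
Proof.
move=> q0; rewrite -mulc_conj /gauss_sum rmorph_sum /= mulr_sumr.
transitivity (\sum_(n < q) \sum_(h < q)
   gauss_phase R q a1 a2 h * rexp R q (2 * a2 * h * n)).
  apply: eq_bigr => n _.
  rewrite -(sum_periodic_shift n (gauss_phase_periodic R a1 a2 q0)) mulr_suml.
  apply: eq_bigr => h _.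
  have -> : gauss_phase R q a1 a2 (n + h) = gauss_phase R q a1 a2 n *
      (gauss_phase R q a1 a2 h * rexp R q (2 * a2 * h * n)).
    by rewrite /gauss_phase -!rexpD; congr rexp; ring.
  by rewrite mulrAC rexp_conj mul1r.
rewrite exchange_big /= mulr_sumr [RHS]big_mkcond; apply: eq_bigr => h _ /=.
by rewrite -mulr_sumr sum_rexp //; case: ifP => _; rewrite ?mulr0 // mulrC.
Qed.

(** Here q is prime to 2 a2, so only h = 0 survives in [gauss_sum_sqr]. *)
Lemma gauss_sum_odd (R : realType) (q a1 a2 : nat) : odd q -> coprime a2 q ->
  normc (gauss_sum R q a1 a2) ^+ 2 = q%:R.
Proof.
move=> oq cq; have q0 : (0 < q)%N by case: q oq {cq}.
have := gauss_sum_sqr R a1 a2 q0.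
have c2 : coprime q (2 * a2) by rewrite coprimeMr coprimen2 oq coprime_sym.
rewrite (bigD1 (Ordinal q0)) /= ?muln0 ?dvdn0 // big1 ?addr0; last first.
  move=> h /andP[]; rewrite Gauss_dvdr // => qh hn0; exfalso.
  move: hn0; rewrite -val_eqE /= -lt0n => /dvdn_leq /(_ qh).
  by rewrite leqNgt ltn_ord.
rewrite /gauss_phase !muln0 rexp0 mulr1 -(rmorph_nat (real_complex R)).
by move=> /complexI.
Qed.

(** The surviving shifts are h = 0 and h = p. The phase at p is (a1 + a2 p) p; as a2 is odd and a1
    has the parity of p, it is a multiple of 2p, and both terms equal 1. *)
Lemma gauss_sum_even (R : realType) (p a1 a2 : nat) :
  (0 < p)%N -> coprime a2 (2 * p) -> odd a1 = odd p ->
  normc (gauss_sum R (2 * p) a1 a2) ^+ 2 = (2 * (2 * p))%:R.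
Proof.
move=> p0 cq a1p; have q0 : (0 < 2 * p)%N by rewrite muln_gt0.
have := gauss_sum_sqr R a1 a2 q0.
have cp : coprime p a2 by move: cq; rewrite coprimeMr coprime_sym => /andP[_]; rewrite coprime_sym.
have oa : odd a2 by move: cq; rewrite coprimeMr coprimen2 => /andP[].
have pq : (p < 2 * p)%N by rewrite ltn_Pmull.
rewrite (bigD1 (Ordinal q0)) /= ?muln0 ?dvdn0 //.
rewrite (bigD1 (Ordinal pq)) /=; last first.
  rewrite -val_eqE /= -lt0n p0 andbT.
  by rewrite mulnAC dvdn_mulr.
rewrite big1 ?addr0; last first.
  move=> h /andP[/andP[]]; rewrite -mulnA dvdn_pmul2l // Gauss_dvdr // -!val_eqE /=.
  move=> /dvdnP[j hj] h0 hp; exfalso.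
  have := ltn_ord h; rewrite hj ltn_pmul2r //.
  by case: j hj => [|[|j]] // hj; [rewrite hj in h0|rewrite hj mul1n eqxx in hp].
rewrite /gauss_phase !muln0 rexp0.
have -> : rexp R (2 * p) (a1 * p + a2 * p ^ 2) = 1.
  apply: rexp_dvd => //.
  have -> : (a1 * p + a2 * p ^ 2 = (a1 + a2 * p) * p)%N by ring.
  by rewrite dvdn_pmul2r // dvdn2 oddD oddM oa a1p /= addbb.
have -> : (2 * p)%:R * (1 + 1) = ((2 * (2 * p))%:R)%:C%C :> R[i].
  by rewrite (rmorph_nat (real_complex R)) -[1 + 1]/(2%:R) -natrM mulnC.
by move=> /complexI.
Qed.

(* For even q the terms h = 0 and h = q/2 both survive in [gauss_sum_sqr]; the parity of a1 decides
   whether they add up or cancel. *)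
Lemma gauss_sum_bounds (R : realType) (q a1 a2 : nat) :
  (0 < q)%N -> coprime a2 q -> (~~ odd q -> odd a1 = odd q./2) ->
  q%:R <= normc (gauss_sum R q a1 a2) ^+ 2 <= 2 * q%:R.
Proof.
move=> q0 cq par; case: (boolP (odd q)) => oq.
  rewrite gauss_sum_odd // lexx /=.
  by rewrite -[leLHS]mul1r ler_wpM2r ?ler0n // ler1n.
have e : q = (2 * q./2)%N by rewrite mul2n even_halfK.
have -> : gauss_sum R q a1 a2 = gauss_sum R (2 * q./2) a1 a2 by rewrite -e.
rewrite gauss_sum_even; last 3 first.
- by move: q0; rewrite {1}e muln_gt0.
- by rewrite -e.
- exact: par.
by rewrite -e natrM lexx andbT -[leLHS]mul1r ler_wpM2r ?ler0n // ler1n.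
Qed.

(** * The sum near a rational point *)

(** By induction: passing from N to N + 1 changes the error by the partial sum up to N + 1 times the
    increment of g. The reference value [g N] lies one past the last term, which lets each step
    close exactly. *)
Lemma abel_summation_le (R : realType) (u g : nat -> R[i]) (N : nat) (B d : R) :
  (forall n, (n <= N)%N -> normc (\sum_(k < n) u k) <= B) ->
  (forall n, (n < N)%N -> normc (g n.+1 - g n) <= d) ->
  normc (\sum_(k < N) u k * g k - (\sum_(k < N) u k) * g N) <= N%:R * (B * d).
Proof.
elim: N => [|N IH] uB gd.
  by rewrite !big_ord0 mul0r subrr normc0 mul0r.
have {}IH := IH (fun n nN => uB n (leqW nN)) (fun n nN => gd n (leqW nN)).
rewrite !big_ord_recr /=; set s := \sum_(k < N) u k * g k in IH *.
have := uB N.+1 (leqnn _); rewrite big_ord_recr /=.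
set U := \sum_(k < N) u k in IH * => UB.
have -> : s + u N * g N - (U + u N) * g N.+1 =
  (s - U * g N) - (U + u N) * (g N.+1 - g N) by ring.
apply: le_trans (normcB _ _) _; rewrite normcM -natr1 mulrDl mul1r.
by rewrite lerD // ler_pM ?normc_ge0 // gd.
Qed.

Lemma S2_gauss (R : realType) (q a1 a2 N : nat) (b1 b2 : R) :
  S2 (a1%:R / q%:R + b1, a2%:R / q%:R + b2) N =
  \sum_(n < N) gauss_phase R q a1 a2 n.+1 *
     expi (b1 * n.+1%:R + b2 * n.+1%:R ^+ 2).
Proof.
rewrite /S2 big_add1 /= big_mkord; apply: eq_bigr => n _.
rewrite /gauss_phase /rexp -expiD; congr expi.
rewrite natrD !natrM; ring.
Qed.

Lemma expi_quad_diff (R : realType) (b1 b2 e : R) (N n : nat) : (n < N)%N ->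
  0 <= b1 <= e / N%:R -> 0 <= b2 <= e / N%:R ^+ 2 ->
  normc (expi (b1 * n.+2%:R + b2 * n.+2%:R ^+ 2) -
         expi (b1 * n.+1%:R + b2 * n.+1%:R ^+ 2)) <= 32 * e / N%:R.
Proof.
move=> nN /andP[b10 b1e] /andP[b20 b2e].
have N0 : 0 < N%:R :> R by rewrite ltr0n (leq_ltn_trans _ nN).
(* [v] is the increment of the phase. It is at most 4 e / N because 2 n + 3 <= 3 N, and
   [normc_expi_sub1_le] contributes the factor 8. *)
set t := b1 * n.+1%:R + _; set v := b1 + b2 * (2 * n + 3)%:R.
have -> : b1 * n.+2%:R + b2 * n.+2%:R ^+ 2 = v + t.
  by rewrite /v /t natrD natrM -(natr1 n.+1) -(natr1 n); ring.
rewrite expiD -[X in _ - X]mul1r -mulrBl normcM normc_expi mulr1.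
apply: le_trans (normc_expi_sub1_le _) _.
rewrite ger0_norm ?addr_ge0 ?mulr_ge0 //.
suff : v <= 4 * (e / N%:R) by rewrite -mulrA; lra.
have : b2 * (2 * n + 3)%:R <= 3 * (e / N%:R).
  have -> : 3 * (e / N%:R) = (e / N%:R ^+ 2) * (3 * N%:R) by field; lra.
  rewrite ler_pM ?ler0n // -natrM ler_nat; lia.
by rewrite /v; lra.
Qed.

(* Any value <= 1/384 works: the Abel summation error is 3 * 32 * arc_eps * N / sqrt q, and it must
   stay below N / (4 sqrt q). *)
Definition arc_eps (R : realType) : R := 400^-1.

Lemma arc_eps_gt0 (R : realType) : 0 < arc_eps R.
Proof. by rewrite /arc_eps invr_gt0 ltr0n. Qed.

Lemma arc_eps_le1 (R : realType) : arc_eps R <= 1.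
Proof. by rewrite /arc_eps invf_le1 ?ltr0n // ler1n. Qed.

(** Put X = N / sqrt q. At the rational point, the complete periods contribute at least 7/8 X and
    the tail at most X/8, which leaves 3/4 X. Moving to the nearby point costs less than X/4 by Abel
    summation. *)
Lemma S2_near_rational (R : realType) (q a1 a2 N : nat) (b1 b2 : R) :
  (0 < q)%N -> (8 * q <= N)%N -> coprime a2 q ->
  (~~ odd q -> odd a1 = odd q./2) ->
  (forall r, (r < q)%N -> normc (\sum_(h < r) gauss_phase R q a1 a2 h.+1) <=
     N%:R / (8 * Num.sqrt q%:R)) ->
  0 <= b1 <= arc_eps R / N%:R -> 0 <= b2 <= arc_eps R / N%:R ^+ 2 ->
  N%:R / (2 * Num.sqrt q%:R) <=
    normc (S2 (a1%:R / q%:R + b1, a2%:R / q%:R + b2) N).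
Proof.
move=> q0 qN cq par tail hb1 hb2.
have q0R : 0 < q%:R :> R by rewrite ltr0n.
have N0 : 0 < N%:R :> R by rewrite ltr0n; lia.
set w := Num.sqrt q%:R in tail *.
have w0 : 0 < w by rewrite sqrtr_gt0.
have w2 : w ^+ 2 = q%:R by rewrite sqr_sqrtr ?ler0n.
have /andP[gl gu] := gauss_sum_bounds R q0 cq par.
have Gn : \sum_(h < q) gauss_phase R q a1 a2 h.+1 = gauss_sum R q a1 a2.
  exact: (sum_periodic_shift 1 (gauss_phase_periodic R a1 a2 q0)).
have split n : \sum_(h < n) gauss_phase R q a1 a2 h.+1 =
    gauss_sum R q a1 a2 *+ (n %/ q)%N + \sum_(h < (n %% q)%N) gauss_phase R q a1 a2 h.+1.
  rewrite -Gn; apply: (@sum_periodic_split _ q n (fun h => gauss_phase R q a1 a2 h.+1)) => // k.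
  by rewrite -addSn gauss_phase_periodic.
set g := normc (gauss_sum R q a1 a2) in gl gu.
have g0 : 0 <= g by exact: normc_ge0.
(* The Gauss sum lies between sqrt q and sqrt(2 q); 3/2 serves as a rational upper bound for sqrt
   2. *)
have gw : w <= g by rewrite leNgt; apply/negP => ?; rewrite -w2 in gl; nra.
have gw2 : g <= 3 / 2 * w by rewrite leNgt; apply/negP => ?; rewrite -w2 in gu; nra.
have tail' n : normc (\sum_(h < (n %% q)%N) gauss_phase R q a1 a2 h.+1) <= N%:R / w / 8.
  by apply: le_trans (tail _ _) _; rewrite ?ltn_mod // invfM; lra.
have gX n : normc (gauss_sum R q a1 a2 *+ n) = n%:R * g.
  by rewrite -(mulr_natl (gauss_sum R q a1 a2)) normcM normc_nat.
set X := N%:R / w in tail'.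
have Xw : X * w = N%:R by rewrite /X divfK // gt_eqF.
have X0 : 0 < X by rewrite divr_gt0.
have ub n : (n <= N)%N -> normc (\sum_(h < n) gauss_phase R q a1 a2 h.+1) <= 3 * X.
  move=> nN; rewrite split; apply: le_trans (normcD _ _) _; rewrite gX.
  move: (tail' n); suff : (n %/ q)%N%:R * g <= 3 / 2 * X by lra.
  have h1 : (n %/ q)%N%:R * q%:R <= N%:R :> R.
    by rewrite -natrM ler_nat (leq_trans (leq_divM _ _)).
  have h2 : (n %/ q)%N%:R * w <= X.
    rewrite -(ler_pM2r w0) Xw -mulrA -expr2 w2 //.
  have : (n %/ q)%N%:R * g <= (n %/ q)%N%:R * (3 / 2 * w) by rewrite ler_wpM2l ?ler0n.
  lra.
have lb : 3 / 4 * X <= normc (\sum_(h < N) gauss_phase R q a1 a2 h.+1).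
  rewrite split; set T := \sum_(h < (N %% q)%N) _.
  have := normcB_ge (gauss_sum R q a1 a2 *+ (N %/ q)%N) (- T).
  rewrite opprK normc_opp gX => /(le_trans _); apply.
  have := tail' N; rewrite -/T => hT.
  have h1 : N%:R <= ((N %/ q)%N%:R + 1) * q%:R :> R.
    by rewrite natr1 -natrM ler_nat ltnW // ltn_ceil.
  (* Rounding N / q down loses at most one period, hence at most w, and 8 q <= N makes w at most
     X/8. *)
  have h2 : X - w <= (N %/ q)%N%:R * w.
    rewrite -(ler_pM2r w0) mulrBl Xw -mulrA -expr2 w2; lra.
  have h3 : w <= X / 8.
    rewrite -(ler_pM2r w0) mulrAC Xw -expr2 w2.
    have : 8 * q%:R <= N%:R :> R by rewrite -natrM ler_nat.
    lra.
  have : (N %/ q)%N%:R * w <= (N %/ q)%N%:R * g by rewrite ler_wpM2l ?ler0n.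
  lra.
rewrite S2_gauss.
have := @abel_summation_le R (fun h => gauss_phase R q a1 a2 h.+1)
  (fun h => expi (b1 * h.+1%:R + b2 * h.+1%:R ^+ 2)) N (3 * X) (32 * arc_eps R / N%:R)
  ub (fun n nN => expi_quad_diff nN hb1 hb2).
set S := \sum_(n < N) _; set U := \sum_(k < N) _ => h.
have hU : normc (U * expi (b1 * N.+1%:R + b2 * N.+1%:R ^+ 2)) = normc U.
  by rewrite normcM normc_expi mulr1.
set Ue := U * _ in h hU.
have := normcB_ge Ue (- (S - Ue)).
rewrite opprK (addrC Ue) subrK normc_opp hU.
move=> hS.
have e : N%:R * (3 * X * (32 * arc_eps R / N%:R)) = 96 / 400 * X.
  by rewrite /arc_eps; field; lra.
rewrite e in h.
have -> : N%:R / (2 * w) = X / 2 by rewrite /X; field; lra.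
rewrite -/U in lb.
lra.
Qed.

(** * Incomplete Gauss sums *)

Lemma sum_inv_le_ln (R : realType) (n : nat) :
  \sum_(1 <= k < n.+2) (k%:R^-1 : R) <= 1 + ln n.+1%:R.
Proof.
elim: n => [|n IH]; first by rewrite big_nat1 invr1 ln1 addr0.
rewrite big_nat_recr //=; apply: le_trans (lerD IH (lexx _)) _.
rewrite -addrA lerD2l.
have n0 : 0 < n.+1%:R :> R by rewrite ltr0n.
have n1 : 0 < n.+2%:R :> R by rewrite ltr0n.
have := @le_ln1Dx R (n.+1%:R / n.+2%:R - 1).
have -> : n.+1%:R / n.+2%:R - 1 = - n.+2%:R^-1 :> R.
  by rewrite -(natr1 n.+1) in n1 *; field; lra.
have v1 : n.+2%:R^-1 < 1 :> R by rewrite invf_lt1 // ltr1n.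
have -> : 1 - n.+2%:R^-1 = n.+1%:R / n.+2%:R :> R.
  by rewrite -(natr1 n.+1) in n1 *; field; lra.
rewrite ln_div ?posrE // ltrN2 => /(_ v1) h.
by rewrite -lerBrDr addrC -lerBlDr.
Qed.

(** The Fourier coefficients of the quadratic phase mod q are Gauss sums with linear coefficient j +
    a1. For odd q all have modulus sqrt q, whatever the parity of j + a1, so it remains to bound the
    l1 norm of the Fourier transform of an interval. *)
Lemma gauss_tail_le (R : realType) (q a1 a2 r : nat) :
  odd q -> coprime a2 q -> (r < q)%N ->
  normc (\sum_(h < r) gauss_phase R q a1 a2 h.+1) <=
    Num.sqrt q%:R * (5 + 4 * ln q%:R).
Proof.
move=> oq cq rq; have q0 : (0 < q)%N by case: q oq {cq rq}.
have q0R : 0 < q%:R :> R by rewrite ltr0n.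
set T := \sum_(h < r) _.
pose F n := gauss_phase R q a1 a2 n.+1.
(* Completion: expand the indicator function of [n = m] in additive characters mod q; [q - 1] plays
   the role of [-1]. *)
have FE : q%:R * T = \sum_(j < q) (\sum_(n < q) F n * rexp R q (j * n)) *
    (\sum_(m < r) rexp R q ((q - 1) * j * m)).
  transitivity (\sum_(m < r) \sum_(n < q) F n *
      \sum_(j < q) rexp R q ((n + (q - 1) * m) * j)).
    rewrite mulr_sumr; apply: eq_bigr => m _.
    have mq : (m < q)%N := ltn_trans (ltn_ord m) rq.
    have qm (n : nat) : ((n + (q - 1) * m) + m = n %[mod q])%N.
      by rewrite -addnA -mulSnr -addn1 subnK // addnC mulnC modnMDl.
    rewrite (bigD1 (Ordinal mq)) //= sum_rexp // ifT; last first.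
      by rewrite -mulSn -addn1 subnK // dvdn_mulr.
    rewrite [X in _ + X]big1; first by rewrite addr0 mulrC.
    move=> n nm; rewrite sum_rexp // ifF ?mulr0 //; apply/negP => qd.
    move: nm; rewrite -val_eqE /= => /eqP; apply.
    have := qm n; move/eqP: qd => qd; rewrite -modnDml qd add0n.
    by rewrite !modn_small.
  transitivity (\sum_(m < r) \sum_(n < q) \sum_(j < q)
      F n * rexp R q (j * n) * rexp R q ((q - 1) * j * m)).
    apply: eq_bigr => m _; apply: eq_bigr => n _; rewrite mulr_sumr.
    apply: eq_bigr => j _; rewrite -mulrA -rexpD; congr (_ * rexp _ _ _); ring.
  rewrite exchange_big /=.
  under eq_bigr do rewrite exchange_big /=.
  rewrite exchange_big /=; apply: eq_bigr => j _.
  rewrite mulr_suml; apply: eq_bigr => n _; rewrite mulr_sumr //.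
have GE (j : 'I_q) : normc (\sum_(n < q) F n * rexp R q (j * n)) = Num.sqrt q%:R.
  have -> : \sum_(n < q) F n * rexp R q (j * n) =
      gauss_sum R q (j + a1) a2 * conjc (rexp R q j).
    rewrite /gauss_sum -(sum_periodic_shift 1 (gauss_phase_periodic R (j + a1) a2 q0)).
    rewrite mulr_suml; apply: eq_bigr => n _.
    rewrite -[LHS]mulr1 -(rexp_conj R q j) mulrA; congr (_ * _).
    rewrite /F /gauss_phase -!rexpD add1n; congr rexp; ring.
  rewrite normcM normc_conj normc_rexp mulr1.
  by rewrite -(gauss_sum_odd R (j + a1) oq cq) sqrtr_sqr ger0_norm // normc_ge0.
have : q%:R * normc T <= Num.sqrt q%:R * (q%:R * (5 + 4 * ln q%:R)).
  rewrite -(normc_nat R q) -normcM FE normc_nat.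
  apply: le_trans (normc_sum _ _ _) _.
  under eq_bigr do rewrite normcM GE.
  rewrite -mulr_sumr ler_wpM2l ?sqrtr_ge0 //.
  have -> : \sum_(j < q) normc (\sum_(m < r) rexp R q ((q - 1) * j * m)) =
    \sum_(0 <= j < q) normc (\sum_(m < r) rexp R q ((q - 1) * j * m)).
    by rewrite big_mkord.
  (* The frequency j = 0 contributes r, at most q. Each other j contributes at most 2 q / min(j, q -
     j), and 1 / min(j, q - j) <= 1/j + 1/(q - j) leads to two harmonic sums. *)
  rewrite big_ltn // muln0.
  have -> : \sum_(m < r) rexp R q (0 * m) = r%:R.
    rewrite (eq_bigr (fun=> 1)) ?sumr_const ?card_ord // => m _.
    by rewrite mul0n rexp0.
  rewrite normc_nat.
  have -> : q%:R * (5 + 4 * ln q%:R) =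
     q%:R + 2 * q%:R * ((1 + ln q%:R) + (1 + ln q%:R)) :> R by ring.
  apply: lerD; first by rewrite ler_nat ltnW.
  have H : \sum_(1 <= j < q) (j%:R^-1 : R) <= 1 + ln q%:R.
    have := sum_inv_le_ln R q.-1; rewrite prednK // big_nat_recr //=.
    by apply: le_trans; rewrite lerDl.
  apply: (@le_trans _ _ (\sum_(1 <= j < q) 2 * q%:R * (j%:R^-1 + (q - j)%N%:R^-1 : R))).
    rewrite big_nat_cond [leRHS]big_nat_cond; apply: ler_sum => j /andP[/andP[j1 jq] _].
    have kq : (0 < q - j < q)%N by lia.
    have -> : \sum_(m < r) rexp R q ((q - 1) * j * m) = \sum_(m < r) rexp R q ((q - j) * m).
      apply: eq_bigr => m _; apply: rexp_modn => //.
      have -> : ((q - 1) * j * m = (j - 1) * m * q + (q - j) * m)%N.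
        rewrite [((j - 1) * m * q)%N]mulnAC -mulnDl; congr (_ * _)%N.
        by rewrite !mulnBl !mul1n; nia.
      by rewrite modnMDl.
    apply: le_trans (sum_rexp_partial_le R r kq) _; rewrite ler_wpM2l ?mulr_ge0 //.
    rewrite subKn ?(ltnW jq) // /minn; case: ifP => _.
      by rewrite lerDr invr_ge0.
    by rewrite lerDl invr_ge0.
  rewrite -mulr_sumr ler_wpM2l ?mulr_ge0 // big_split /= lerD //.
  rewrite big_nat_rev /= (eq_big_nat _ _ (F2 := fun j => j%:R^-1)) // => j jq.
  congr (_ ^-1 ); congr (_%:R); lia.
by rewrite mulrCA ler_pM2l.
Qed.

(** * Integrals over boxes *)

Lemma S2E (R : realType) (N : nat) (x : R * R) :
  S2 x N = Complex (\sum_(n < N) cos (2 * pi * (x.1 * n.+1%:R + x.2 * n.+1%:R ^+ 2)))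
                   (\sum_(n < N) sin (2 * pi * (x.1 * n.+1%:R + x.2 * n.+1%:R ^+ 2))).
Proof.
rewrite /S2 big_add1 /= big_mkord; elim: N => [|N IH]; first by rewrite !big_ord0.
by rewrite !big_ord_recr /= IH; simpc.
Qed.

Lemma measurable_normc_S2 (R : realType) (N : nat) :
  measurable_fun [set: R * R] (fun x => normc (S2 x N)).
Proof.
have mphase (n : nat) : measurable_fun [set: R * R]
    (fun x => 2 * pi * (x.1 * n%:R + x.2 * n%:R ^+ 2)).
  apply: measurable_funM => //; apply: measurable_funD; apply: measurable_funM => //.
pose X (x : R * R) := \sum_(n < N) cos (2 * pi * (x.1 * n.+1%:R + x.2 * n.+1%:R ^+ 2)).
pose Y (x : R * R) := \sum_(n < N) sin (2 * pi * (x.1 * n.+1%:R + x.2 * n.+1%:R ^+ 2)).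
have -> : (fun x => normc (S2 x N)) = (fun x => Num.sqrt (X x ^+ 2 + Y x ^+ 2)).
  by apply/funext => x; rewrite S2E.
have mX : measurable_fun setT X.
  apply: measurable_sum => n; apply: (measurableT_comp (f := cos)) => //.
  exact: continuous_measurable_fun (@continuous_cos R).
have mY : measurable_fun setT Y.
  apply: measurable_sum => n; apply: (measurableT_comp (f := sin)) => //.
  exact: continuous_measurable_fun (@continuous_sin R).
apply: (measurableT_comp (f := @Num.sqrt R)).
  exact: continuous_measurable_fun (@sqrt_continuous R).
by apply: measurable_funD; apply: measurable_funX.
Qed.

Lemma measurable_I2_integrand (R : realType) (s : R) (N : nat) :
  measurable_fun [set: R * R] (fun x => (normc (S2 x N) `^ (2 * s))%:E).
Proof.
apply/measurable_EFinP; apply: (measurableT_comp (f := @powR R ^~ (2 * s))).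
  exact: measurable_powR.
exact: measurable_normc_S2.
Qed.

Lemma measurable_box (R : realType) (delta : R) (xi : R * R) : measurable (box delta xi).
Proof. exact: measurableX. Qed.

Lemma lebesgue_measure_segment (R : realType) (a w : R) : 0 <= w ->
  @lebesgue_measure R `[a, a + w]%classic = w%:E.
Proof.
move=> w0; rewrite lebesgue_measure_itv /= lte_fin ltrDl.
case: ifPn => [_|]; first by rewrite -EFinD addrC addKr.
by rewrite -leNgt => w1; congr EFin; apply/le_anti/andP.
Qed.

Lemma I2_ge_rectangles (R : realType) (s delta : R) (xi : R * R) (N n : nat)
    (p : 'I_n -> R * R) (w h v : R) :
  0 < s -> 0 < w -> 0 < h -> 0 <= v ->
  (forall i, xi.1 <= (p i).1 /\ (p i).1 + w <= xi.1 + delta) ->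
  (forall i, xi.2 <= (p i).2 /\ (p i).2 + h <= xi.2 + delta) ->
  (forall i j, i != j -> w < `|(p i).1 - (p j).1| \/ h < `|(p i).2 - (p j).2|) ->
  (forall i b1 b2, 0 <= b1 <= w -> 0 <= b2 <= h ->
     v <= normc (S2 ((p i).1 + b1, (p i).2 + b2) N)) ->
  ((v `^ (2 * s) * (n%:R * (w * h)))%:E <= I2 s delta xi N)%E.
Proof.
move=> s0 w0 h0 v0 px py pd pv.
pose Q (i : 'I_n) : set (R * R) :=
  `[(p i).1, (p i).1 + w]%classic `*` `[(p i).2, (p i).2 + h]%classic.
pose D := \big[setU/set0]_(i < n) Q i.
pose f (x : R * R) := (normc (S2 x N) `^ (2 * s))%:E.
have mQ i : measurable (Q i) by exact: measurableX.
have mD : measurable D by exact: bigsetU_measurable.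
have DE x : D x -> exists i, Q i x.
  rewrite /D; elim/big_ind: _ => //=; last by move=> i _ Qx; exists i.
  by move=> A B HA HB [/HA|/HB].
have mf : measurable_fun setT f by exact: measurable_I2_integrand.
have f0 x : (0 <= f x)%E by rewrite lee_fin powR_ge0.
have DB : D `<=` box delta xi.
  move=> x /DE [i []]; rewrite /= !in_itv /= => /andP[a1 a2] /andP[a3 a4].
  have [q1 q2] := px i; have [q3 q4] := py i.
  by split; rewrite /= in_itv /=; apply/andP; split; lra.
have -> : I2 s delta xi N = (\int[(lebesgue_measure \x lebesgue_measure)]_(x in box delta xi) f x)%E by [].
apply: (@le_trans _ _ (\int[(@lebesgue_measure R \x @lebesgue_measure R)]_(x in D) f x)%E); last first.
  apply: ge0_subset_integral => //; first exact: measurable_box.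
  exact: measurable_funTS.
apply: (@le_trans _ _ (\int[(@lebesgue_measure R \x @lebesgue_measure R)]_(x in D) (v `^ (2 * s))%:E)%E); last first.
  apply: ge0_le_integral => //.
  - by move=> x _; rewrite lee_fin powR_ge0.
  - exact: measurable_funTS.
  - move=> x /DE [i [] /=]; rewrite !in_itv /= => /andP[a1 a2] /andP[a3 a4].
    have vx : v <= normc (S2 x N).
      have := pv i (x.1 - (p i).1) (x.2 - (p i).2).
      rewrite ![_ + (_ - _)]addrC !subrK -surjective_pairing; apply; lra.
    by rewrite lee_fin; apply: ge0_ler_powR; rewrite ?nnegrE ?normc_ge0 ?mulr_ge0 // ltW.
rewrite integral_cst // EFinM; apply: lee_wpmul2l; first by rewrite lee_fin powR_ge0.
rewrite /D measure_bigsetU_ord //.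
  rewrite (eq_bigr (fun=> (w * h)%:E)).
    by rewrite sumEFin sumr_const card_ord mulr_natl.
  move=> i _; rewrite [LHS](_ : _ = (@lebesgue_measure R \x @lebesgue_measure R)%E (Q i)) //.
  rewrite /Q product_measure1E // EFinM.
  by congr (_ * _)%E; apply: lebesgue_measure_segment; exact: ltW.
move=> i j _ _ [x [[]] /=]; rewrite !in_itv /= => /andP[a1 a2] /andP[a3 a4].
move=> [] /=; rewrite !in_itv /= => /andP[b1 b2] /andP[b3 b4].
apply/eqP/negPn/negP => /pd; rewrite !ltNge !ler_norml; case; move/negP; apply; lra.
Qed.

(** * Mean square *)

Lemma is_derive_sin_affine (R : realType) (c k y : R) :
  is_derive y 1 (fun y => sin (2 * pi * (c + k * y)))
    (2 * pi * k * cos (2 * pi * (c + k * y))).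
Proof.
have h : is_derive y 1 (fun y : R => 2 * pi * (c + k * y)) (2 * pi * k).
  apply: is_derive_eq; rewrite /GRing.scale /=; ring.
have -> : 2 * pi * k * cos (2 * pi * (c + k * y)) = cos (2 * pi * (c + k * y)) * (2 * pi * k).
  by rewrite mulrC.
exact: (@is_derive1_comp R sin _ y _ _ (is_derive_sin _) h).
Qed.

Lemma continuous_cos_affine (R : realType) (c k : R) :
  continuous (fun y : R => cos (2 * pi * (c + k * y))).
Proof.
move=> y; apply: (continuous_comp (f := fun y => 2 * pi * (c + k * y))); last exact: continuous_cos.
apply: cvgM; first exact: cvg_cst.
apply: cvgD; first exact: cvg_cst.
apply: cvgM; first exact: cvg_cst.
exact: cvg_id.
Qed.

(* The Hann window on [a, a + d]: being 1 minus a cosine of period d, it makes the Fourier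
   coefficient at frequency k decay like 1/(d^2 k^3). *)
Definition hann (R : realType) (a d y : R) : R := 1 - cos (2 * pi * ((y - a) / d)).

Lemma hann_bounds (R : realType) (a d y : R) : 0 <= hann a d y <= 2.
Proof.
by have := cos_le1 (2 * pi * ((y - a) / d)); have := cos_geN1 (2 * pi * ((y - a) / d));
  rewrite /hann => ? ?; apply/andP; split; lra.
Qed.

Lemma continuous_hann (R : realType) (a d : R) : continuous (hann a d).
Proof.
have -> : hann a d = fun y => 1 - cos (2 * pi * (- a / d + d^-1 * y)).
  by apply/funext => y; rewrite /hann; congr (1 - cos (_ * _)); ring.
move=> y; apply: cvgB; [exact: cvg_cst|exact: continuous_cos_affine].
Qed.

(** The product of the window with a cosine of frequency k is a combination of cosines of
    frequencies k, k + 1/d and k - 1/d; this is the termwise antiderivative. *)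
Definition hann_prim (R : realType) (a d c k y : R) : R :=
  sin (2 * pi * (c + k * y)) / (2 * pi * k)
  - sin (2 * pi * (c - a / d + (k + d^-1) * y)) / (4 * pi * (k + d^-1))
  - sin (2 * pi * (c + a / d + (k - d^-1) * y)) / (4 * pi * (k - d^-1)).

Lemma is_derive_hann_prim (R : realType) (a d c k y : R) :
  k != 0 -> k + d^-1 != 0 -> k - d^-1 != 0 ->
  is_derive y 1 (hann_prim a d c k) (hann a d y * cos (2 * pi * (c + k * y))).
Proof.
move=> k0 kp km.
have p0 : (pi : R) != 0 by rewrite gt_eqF // pi_gt0.
have h1 := is_derive_sin_affine c k y.
have h2 := is_derive_sin_affine (c - a / d) (k + d^-1) y.
have h3 := is_derive_sin_affine (c + a / d) (k - d^-1) y.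
rewrite /hann_prim; apply: is_derive_eq.
rewrite /GRing.scale /= !mulr0 !add0r /hann.
have -> : 2 * pi * (c - a / d + (k + d^-1) * y) =
  2 * pi * (c + k * y) + 2 * pi * ((y - a) / d) by ring.
have -> : 2 * pi * (c + a / d + (k - d^-1) * y) =
  2 * pi * (c + k * y) - 2 * pi * ((y - a) / d) by ring.
rewrite cosB cosD.
set C := cos (2 * pi * (c + k * y)); set D := cos (2 * pi * ((y - a) / d)).
set E := sin (2 * pi * (c + k * y)); set F := sin (2 * pi * ((y - a) / d)).
move: p0 kp km; clearbody C D E F; clear h1 h2 h3.
move: (pi : R) (d^-1) => P u p0 kp km.
by field; rewrite p0 kp km k0.
Qed.

Lemma sin_add2pi (R : realType) (x : R) : sin (x + 2 * pi) = sin x.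
Proof. by rewrite mulr_natl sinD2pi. Qed.

Lemma sin_sub2pi (R : realType) (x : R) : sin (x - 2 * pi) = sin x.
Proof. by rewrite -[LHS]sin_add2pi subrK. Qed.

(** At each end of the window the three sines agree, since the shifts of frequency change the
    argument by whole turns only. Their coefficients then combine to [e], of order 1/(d^2 k^3), and
    |k| >= 2/d trades one factor 1/|k| for d. *)
Lemma hann_prim_diff_le (R : realType) (a d c k : R) :
  0 < d -> 2 / d <= `|k| ->
  `|hann_prim a d c k (a + d) - hann_prim a d c k a| <= (d * k ^+ 2)^-1.
Proof.
move=> d0 kd; have u0 : 0 < d^-1 by rewrite invr_gt0.
set u := d^-1 in u0 kd *.
have k0 : 0 < `|k| by lra.
have kn0 : k != 0 by rewrite -normr_gt0.
have k2 : `|k| ^+ 2 = k ^+ 2 by rewrite real_normK ?num_real.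
have ku : 4 * u ^+ 2 <= k ^+ 2 by rewrite -k2; nra.
have kp : k + u != 0 by apply: contraTneq ku => ?; rewrite -ltNge; nra.
have km : k - u != 0 by apply: contraTneq ku => ?; rewrite -ltNge; nra.
have p0 : (pi : R) != 0 by rewrite gt_eqF // pi_gt0.
have p2 := @pi_ge2 R.
have kk : k ^+ 2 - u ^+ 2 != 0 by rewrite gt_eqF //; nra.
pose e := - u ^+ 2 / (2 * pi * k * (k ^+ 2 - u ^+ 2)).
have eE : (2 * pi * k)^-1 - (4 * pi * (k + u))^-1 - (4 * pi * (k - u))^-1 = e.
  rewrite /e; move: p0; move: (pi : R) => P p0.
  by field; rewrite p0 kk kp km kn0.
have du : d * u = 1 by rewrite /u divff // gt_eqF.
have -> : hann_prim a d c k (a + d) = sin (2 * pi * (c + k * (a + d))) * e.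
  rewrite /hann_prim -/u -eE !mulrBr.
  have -> : 2 * pi * (c - a * u + (k + u) * (a + d)) = 2 * pi * (c + k * (a + d)) + 2 * pi by ring: du.
  have -> : 2 * pi * (c + a * u + (k - u) * (a + d)) = 2 * pi * (c + k * (a + d)) - 2 * pi by ring: du.
  by rewrite sin_add2pi sin_sub2pi.
have -> : hann_prim a d c k a = sin (2 * pi * (c + k * a)) * e.
  rewrite /hann_prim -/u -eE !mulrBr.
  have -> : c - a * u + (k + u) * a = c + k * a by ring.
  have -> : c + a * u + (k - u) * a = c + k * a by ring.
  by [].
rewrite -mulrBl normrM.
have s2 : `|sin (2 * pi * (c + k * (a + d))) - sin (2 * pi * (c + k * a))| <= 2.
  apply: le_trans (ler_normB _ _) _.
  have := sin_max (2 * pi * (c + k * (a + d))); have := sin_max (2 * pi * (c + k * a)); lra.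
have e1 : `|e| <= u / k ^+ 2 / 2.
  rewrite /e normrM normrN normfV !normrM (ger0_norm (ltW (pi_gt0 R))).
  rewrite -expr2 (ger0_norm (ltW u0)) (@ger0_norm _ 2) // (@ger0_norm _ (k ^+ 2 - u ^+ 2)); last nra.
  have k20 : 0 < k ^+ 2 by rewrite -k2 exprn_gt0.
  rewrite ler_pdivrMr; last by rewrite !mulr_gt0 //; nra.
  have -> : u / k ^+ 2 / 2 * (2 * pi * `|k| * (k ^+ 2 - u ^+ 2)) =
    u * (pi * (1 - u ^+ 2 / k ^+ 2)) * `|k|.
    by move: (pi : R) => P; field; rewrite -normr_gt0 in kn0 *; lra.
  have h : u ^+ 2 / k ^+ 2 <= 4^-1 by rewrite ler_pdivrMr //; lra.
  have : 1 <= pi * (1 - u ^+ 2 / k ^+ 2) by nra.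
  set Z := pi * _ => Z1.
  have : u <= u * Z by rewrite ler_peMr // ltW.
  nra.
have -> : (d * k ^+ 2)^-1 = 2 * (u / k ^+ 2 / 2) by rewrite [RHS]mulrC divfK // invfM.
by rewrite ler_pM.
Qed.

Lemma sum_inv_sqr_le (R : realType) (n : nat) :
  \sum_(1 <= h < n.+1) ((h%:R ^+ 2)^-1 : R) <= 2.
Proof.
(* The strengthened bound makes the induction telescope. *)
suff : \sum_(1 <= h < n.+2) ((h%:R ^+ 2)^-1 : R) <= 2 - n.+1%:R^-1.
  rewrite big_nat_recr //= => h; apply: (@le_trans _ _ (2 - n.+1%:R^-1)).
    by apply: le_trans h; rewrite lerDl invr_ge0 sqr_ge0.
  by rewrite gerBl.
elim: n => [|n IH]; first by rewrite big_nat1 expr1n invr1; lra.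
rewrite big_nat_recr //=; apply: le_trans (lerD IH (lexx _)) _.
have n0 : 0 < n.+1%:R :> R by rewrite ltr0n.
have -> : n.+2%:R = n.+1%:R + 1 :> R by rewrite natr1.
have z0 : 0 < (n.+1%:R + 1)^-1 :> R by rewrite invr_gt0; lra.
rewrite -exprVn.
have e : n.+1%:R^-1 - (n.+1%:R + 1)^-1 = n.+1%:R^-1 * (n.+1%:R + 1)^-1 :> R.
  by field; rewrite !gt_eqF //; lra.
have h : (n.+1%:R + 1)^-1 <= n.+1%:R^-1 :> R by rewrite lef_pV2 ?posrE; lra.
move: (n.+1%:R^-1) ((n.+1%:R + 1)^-1) e h z0 => v z e h z0; nra.
Qed.

Lemma sum_inv_sqr_dist_le (R : realType) (N n : nat) :
  \sum_(0 <= m < N | m != n) (((n%:R - m%:R) ^+ 2)^-1 : R) <= 4.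
Proof.
have nonneg (m : nat) : 0 <= ((n%:R - m%:R) ^+ 2)^-1 :> R by rewrite invr_ge0 sqr_ge0.
(* Extending the range leaves exactly n terms below n and N terms above it, two one-sided sums of at
   most 2 each. *)
apply: (@le_trans _ _ (\sum_(0 <= m < n + N.+1 | m != n) (((n%:R - m%:R) ^+ 2)^-1 : R))).
  rewrite [leRHS](@big_cat_nat _ _ _ N) //=; last lia.
  by rewrite lerDl sumr_ge0.
rewrite (@big_cat_nat _ _ _ n) //=; last lia.
rewrite (@big_ltn_cond _ _ _ n) ?eqxx /=; last lia.
have -> : 4 = 2 + 2 :> R by rewrite -natrD.
apply: lerD.
  rewrite big_nat_rev /= big_mkcond /=.
  apply: le_trans (sum_inv_sqr_le R n).
  rewrite big_add1 /=; apply: ler_sum_nat => m /andP[_ mn].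
  case: ifP => _; last by rewrite invr_ge0 sqr_ge0.
  rewrite add0n -natrB; last by lia.
  by have -> : (n - (n - m.+1) = m.+1)%N by lia.
rewrite big_mkcond /= -{1}[n.+1]add0n big_addn.
apply: le_trans (sum_inv_sqr_le R N).
rewrite big_add1 /=.
have -> : (n + N.+1 - n.+1 = N)%N by lia.
apply: ler_sum_nat => m /andP[_ mn].
case: ifP => _; last by rewrite invr_ge0 sqr_ge0.
by rewrite -sqrrN opprB addnS -addSn natrD addrK.
Qed.

Lemma is_derive_sum_seq (R : realType) (I : Type) (r : seq I) (P : pred I)
    (F : I -> R -> R) (D : I -> R) (y : R) :
  (forall i, P i -> is_derive y 1 (F i) (D i)) ->
  is_derive y 1 (fun y => \sum_(i <- r | P i) F i y) (\sum_(i <- r | P i) D i).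
Proof.
move=> FD; elim: r => [|i r IH].
  under eq_fun do rewrite big_nil; rewrite big_nil; exact: is_derive_cst.
under eq_fun do rewrite big_cons; rewrite big_cons.
by case: ifP => [Pi|_] //; apply: is_deriveD; first exact: FD.
Qed.

Lemma continuous_sum_seq (R : realType) (I : Type) (r : seq I) (P : pred I)
    (F : I -> R -> R) :
  (forall i, P i -> continuous (F i)) ->
  continuous (fun y => \sum_(i <- r | P i) F i y).
Proof.
move=> FC y; elim: r => [|i r IH].
  under eq_fun do rewrite big_nil; exact: cst_continuous.
under eq_fun do rewrite big_cons.
by case: ifP => [Pi|_] //; apply: continuousD => //; exact: FC.
Qed.

(** The real part of the term of index (n, m) in the double sum |S2|^2, as a function of the second
    coordinate y. *)
Definition pair_cos (R : realType) (x1 y : R) (p : nat * nat) : R :=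
  cos (2 * pi * (x1 * (p.1%:R - p.2%:R) + (p.1%:R ^+ 2 - p.2%:R ^+ 2) * y)).

Lemma sum_pair_cos (R : realType) (x1 y : R) (N : nat) (P : pred nat) :
  \sum_(p : 'I_N * 'I_N | P p.1 && P p.2) pair_cos x1 y (p.1.+1, p.2.+1) =
  (\sum_(n < N | P n) cos (2 * pi * (x1 * n.+1%:R + y * n.+1%:R ^+ 2))) ^+ 2 +
  (\sum_(n < N | P n) sin (2 * pi * (x1 * n.+1%:R + y * n.+1%:R ^+ 2))) ^+ 2.
Proof.
rewrite !expr2 !mulr_suml -big_split /=.
rewrite -(pair_big (fun n : 'I_N => P n) (fun n : 'I_N => P n)
  (fun n m : 'I_N => pair_cos x1 y (n.+1, m.+1))) /=.
apply: eq_bigr => n _; rewrite !mulr_sumr -big_split /=; apply: eq_bigr => m _.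
by rewrite /pair_cos -cosB /=; congr cos; ring.
Qed.

(* The pairs left out contribute the squared modulus of a partial sum. *)
Lemma normc_S2_sqr_ge (R : realType) (x1 y : R) (N : nat) (P : pred nat) :
  \sum_(p : 'I_N * 'I_N | ~~ (P p.1 && P p.2)) pair_cos x1 y (p.1.+1, p.2.+1)
   <= normc (S2 (x1, y) N) ^+ 2.
Proof.
have -> : normc (S2 (x1, y) N) ^+ 2 =
   \sum_(p : 'I_N * 'I_N) pair_cos x1 y (p.1.+1, p.2.+1).
  rewrite S2E /= sqr_sqrtr ?addr_ge0 ?sqr_ge0 //.
  by rewrite -(sum_pair_cos x1 y N predT).
rewrite [leRHS](bigID (fun p : 'I_N * 'I_N => P p.1 && P p.2)) /= lerDr.
by rewrite sum_pair_cos addr_ge0 ?sqr_ge0.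
Qed.

Lemma normc_S2_le (R : realType) (x : R * R) (N : nat) : normc (S2 x N) <= N%:R.
Proof.
rewrite /S2 big_add1 /= big_mkord; apply: le_trans (normc_sum _ _ _) _.
by under eq_bigr do rewrite normc_expi; rewrite sumr_const card_ord.
Qed.

Definition freq (R : realType) (p : nat * nat) : R := p.1%:R ^+ 2 - p.2%:R ^+ 2.

(** One of the summation indices, which are the ordinals plus 1, exceeds N/2. The complement is a
    square, as [normc_S2_sqr_ge] requires. *)
Definition far (N : nat) (p : 'I_N * 'I_N) : bool :=
  ~~ ((2 * p.1.+1 <= N)%N && (2 * p.2.+1 <= N)%N).

(** Factor n^2 - m^2 as (n - m)(n + m), with n + m at least N/2. *)
Lemma freq_ge (R : realType) (N : nat) (p : 'I_N * 'I_N) : far p ->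
  `|p.1%:R - p.2%:R| * (N%:R / 2) <= `|freq R (p.1.+1, p.2.+1)|.
Proof.
rewrite /far /freq /= => pf; rewrite subr_sqr normrM.
have -> : p.1.+1%:R - p.2.+1%:R = p.1%:R - p.2%:R :> R by rewrite -!natr1; ring.
rewrite ler_wpM2l // ger0_norm // -natrD ler_pdivrMr // -natrM ler_nat.
move: pf; lia.
Qed.

Lemma sum_far_diag (R : realType) (N : nat) :
  N%:R / 2 <= \sum_(p : 'I_N * 'I_N | far p && (p.1 == p.2)) (1 : R).
Proof.
have -> : \sum_(p : 'I_N * 'I_N | far p && (p.1 == p.2)) (1 : R) =
    \sum_(n < N | ~~ (2 * n.+1 <= N)%N) 1.
  rewrite -(pair_big_dep predT (fun n m : 'I_N => far (n, m) && (n == m)) (fun _ _ => 1)) /=.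
  rewrite [RHS]big_mkcond; apply: eq_bigr => n _.
  under eq_bigl do rewrite andbC eq_sym.
  by rewrite big_mkcondr big_pred1_eq /far /= andbb.
rewrite -(big_mkord (fun n => ~~ (2 * n.+1 <= N)%N) (fun=> 1)).
rewrite (@big_cat_nat _ _ _ N./2) //=; last lia.
rewrite [X in X + _]big1_seq ?add0r; last first.
  move=> n; rewrite mem_index_iota => /andP[]; lia.
rewrite big_nat_cond (eq_bigl (fun n => (N./2 <= n < N)%N && true)); last first.
  by move=> n; lia.
rewrite -big_nat_cond sumr_const_nat -mulr_natl mulr1 ler_pdivrMr // -natrM ler_nat; lia.
Qed.

(** By [freq_ge] each term is at most 4 / (N^2 (n - m)^2); for each of the N values of n, the sum
    over m adds a factor of at most 4. *)
Lemma sum_far_offdiag_le (R : realType) (N : nat) : (0 < N)%N ->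
  \sum_(p : 'I_N * 'I_N | far p && (p.1 != p.2)) ((freq R (p.1.+1, p.2.+1)) ^+ 2)^-1
  <= 16 / N%:R.
Proof.
move=> N0; have N0R : 0 < N%:R :> R by rewrite ltr0n.
apply: (@le_trans _ _ (\sum_(p : 'I_N * 'I_N | p.1 != p.2)
    4 / N%:R ^+ 2 * (((p.1%:R - p.2%:R) ^+ 2)^-1 : R))).
  rewrite [leLHS]big_mkcond [leRHS]big_mkcond; apply: ler_sum => p _.
  case: (boolP (p.1 == p.2)) => [_|pn]; first by rewrite andbF.
  rewrite andbT; case: ifP => [pf|_]; last by rewrite mulr_ge0 // ?divr_ge0 ?invr_ge0 ?sqr_ge0.
  have h := freq_ge R pf.
  have n0 : 0 < `|p.1%:R - p.2%:R| :> R by rewrite normr_gt0 subr_eq0 eqr_nat.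
  rewrite -(real_normK (num_real (freq _ _))) -(real_normK (num_real (p.1%:R - p.2%:R))).
  have -> : 4 / N%:R ^+ 2 * (`|p.1%:R - p.2%:R| ^+ 2)^-1 =
     ((`|p.1%:R - p.2%:R| * (N%:R / 2)) ^+ 2)^-1 :> R.
    by field; rewrite !gt_eqF.
  have q0 : 0 < `|p.1%:R - p.2%:R| * (N%:R / 2) :> R by rewrite mulr_gt0 // divr_gt0.
  by rewrite lef_pV2 ?posrE ?exprn_gt0 // ?ler_pXn2r ?nnegrE // ?ltW // (lt_le_trans q0).
rewrite -mulr_sumr.
rewrite -(pair_big_dep predT (fun n m : 'I_N => n != m)
   (fun n m : 'I_N => ((n%:R - m%:R) ^+ 2)^-1)) /=.
have : \sum_(n < N) \sum_(m < N | n != m) (((n%:R - m%:R) ^+ 2)^-1 : R) <= \sum_(n < N) 4.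
  apply: ler_sum => n _; have := sum_inv_sqr_dist_le R N n.
  rewrite big_mkord; apply: le_trans; rewrite le_eqVlt; apply/orP; left; apply/eqP.
  by apply: eq_bigl => m; rewrite eq_sym.
rewrite sumr_const card_ord => h.
apply: le_trans (ler_wpM2l _ h) _; first by rewrite divr_ge0 // sqr_ge0.
by rewrite -mulr_natl le_eqVlt; apply/orP; left; apply/eqP; field; rewrite gt_eqF.
Qed.

(** The minorant [h] may be negative, so its integral, given by the primitive [H], is first bounded
    by that of its positive part, which still lies below the nonnegative [f]. *)
Lemma integral_ge_real (R : realType) (a b l : R) (f : R -> R) (h H : R -> R) :
  a < b -> continuous h -> (forall y : R, is_derive y 1 H (h y)) ->
  measurable_fun [set: R] f -> (forall y, 0 <= f y) ->
  (forall y, h y <= f y) ->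
  l <= H b - H a ->
  (l%:E <= \int[lebesgue_measure]_(y in `[a, b]) (f y)%:E)%E.
Proof.
move=> ab hc HD mf f0 hf lH.
have FTC : (\int[lebesgue_measure]_(y in `[a, b]) (h y)%:E = (H b)%:E - (H a)%:E)%E.
  apply: continuous_FTC2 => //.
  - exact: continuous_subspaceT.
  - have Hc : continuous H.
      move=> y; apply: differentiable_continuous; apply/derivable1_diffP.
      exact: (@ex_derive _ _ _ _ _ _ _ (HD y)).
    split.
    + by move=> y _; exact: (@ex_derive _ _ _ _ _ _ _ (HD y)).
    + by apply: cvg_at_right_filter; exact: Hc.
    + by apply: cvg_at_left_filter; exact: Hc.
  - by move=> y _; rewrite derive1E; exact: (@derive_val _ _ _ _ _ _ _ (HD y)).
apply: (@le_trans _ _ (\int[lebesgue_measure]_(y in `[a, b]) (h y)%:E)%E).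
  by rewrite FTC -EFinB lee_fin.
rewrite integralE; apply: (@le_trans _ _ (\int[lebesgue_measure]_(y in `[a, b]) (EFin \o h)^\+%E y)%E).
  by apply: geeDl; rewrite oppe_le0; apply: integral_ge0 => y _; exact: funeneg_ge0.
apply: ge0_le_integral => //.
- apply: measurable_funepos; apply/measurable_EFinP; apply: measurable_funTS.
  exact: continuous_measurable_fun.
- by apply/measurable_EFinP; exact: measurable_funTS.
- by move=> y _; rewrite funeposE /= -EFin_max lee_fin ge_max hf f0.
Qed.

(** The antiderivative for frequency k = 0, where the formula of [hann_prim] has a zero
    denominator. *)
Definition hann_int (R : realType) (a d y : R) : R :=
  y - sin (2 * pi * (- a / d + d^-1 * y)) / (2 * pi * d^-1).

Lemma is_derive_hann_int (R : realType) (a d y : R) : d != 0 ->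
  is_derive y 1 (hann_int a d) (hann a d y).
Proof.
move=> d0; have p0 : (pi : R) != 0 by rewrite gt_eqF // pi_gt0.
have h1 := is_derive_sin_affine (- a / d) d^-1 y.
rewrite /hann_int; apply: is_derive_eq.
rewrite /GRing.scale /= !mulr0 !add0r /hann.
have -> : 2 * pi * ((y - a) / d) = 2 * pi * (- a / d + d^-1 * y) by ring.
rewrite mulrA mulVf ?mul1r //.
by rewrite !mulf_neq0 // ?invr_eq0.
Qed.

Lemma hann_int_diff (R : realType) (a d : R) : d != 0 ->
  hann_int a d (a + d) - hann_int a d a = d.
Proof.
move=> d0; rewrite /hann_int.
have -> : 2 * pi * (- a / d + d^-1 * (a + d)) = 0 + 2 * pi by field.
have -> : 2 * pi * (- a / d + d^-1 * a) = 0 by ring.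
by rewrite sin_add2pi sin0; ring.
Qed.

(** The hypothesis on L bounds the power t^(2s) from below by an affine function of t^2, so a mean
    square bound suffices. Against the Hann window, the diagonal minus N/8 gives at least 3/8 N d,
    and the off-diagonal pairs take away at most 16/(d N) <= N d / 4. *)
Lemma inner_integral_ge (R : realType) (x1 a d L s : R) (N : nat) :
  0 < d -> 8 <= d * N%:R -> 0 <= L ->
  (forall t, 0 <= t <= N%:R -> L * (t ^+ 2 - N%:R / 8) <= t `^ (2 * s)) ->
  ((L * (N%:R * d / 16))%:E <=
   \int[lebesgue_measure]_(y in `[a, (a + d)%R]) (normc (S2 (x1, y) N) `^ (2 * s))%:E)%E.
Proof.
move=> d0 dN L0 LP.
have N0 : 0 < N%:R :> R.
  by rewrite -(pmulr_rgt0 _ d0); apply: lt_le_trans dN.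
have N0n : (0 < N)%N by move: N0; rewrite ltr0n.
pose off (p : 'I_N * 'I_N) := far p && (p.1 != p.2).
pose c (p : 'I_N * 'I_N) : R := x1 * (p.1.+1%:R - p.2.+1%:R).
pose k (p : 'I_N * 'I_N) : R := freq R (p.1.+1, p.2.+1).
pose D : R := \sum_(p : 'I_N * 'I_N | far p && (p.1 == p.2)) 1.
have DN : N%:R / 2 <= D by exact: sum_far_diag.
pose P y : R := D + \sum_(p | off p) cos (2 * pi * (c p + k p * y)).
have PE y : P y = \sum_(p : 'I_N * 'I_N | far p) pair_cos x1 y (p.1.+1, p.2.+1).
  rewrite [RHS](bigID (fun p => p.1 == p.2)) /=; congr (_ + _).
  apply: eq_bigr => p /andP[_ /eqP->].
  by rewrite /pair_cos /= !subrr mulr0 mul0r addr0 mulr0 cos0.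
(* The window is at most 2, so half of it is a weight between 0 and 1; this is the source of
   [L / 2]. *)
pose h y : R := L / 2 * (hann a d y * (P y - N%:R / 8)).
pose H y : R := L / 2 * (\sum_(p | off p) hann_prim a d (c p) (k p) y
   + (D - N%:R / 8) * hann_int a d y).
have kd p : off p -> 2 / d <= `|k p|.
  move=> /andP[pf pn]; apply: le_trans (freq_ge R pf).
  have n1 : 1 <= `|p.1%:R - p.2%:R| :> R.
    case: (ltngtP p.1 p.2) => e.
    - by rewrite distrC -natrB ?(ltnW e) // ger0_norm // ler1n subn_gt0.
    - by rewrite -natrB ?(ltnW e) // ger0_norm // ler1n subn_gt0.
    - by move: pn; rewrite -val_eqE /= e eqxx.
  apply: (@le_trans _ _ (N%:R / 2)); last by rewrite ler_peMl // ltW // divr_gt0.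
  rewrite ler_pdivrMr //; lra.
apply: (@integral_ge_real R a (a + d) _ _ h H).
- by rewrite ltrDl.
- move=> y; rewrite /continuous_at /h; apply: cvgM; first exact: cvg_cst.
  apply: cvgM; first exact: continuous_hann.
  apply: cvgB; last exact: cvg_cst.
  apply: cvgD; first exact: cvg_cst.
  by apply: continuous_sum_seq => p _; exact: continuous_cos_affine.
- move=> y.
  have h1 : is_derive y 1 (fun y => \sum_(p | off p) hann_prim a d (c p) (k p) y)
     (\sum_(p | off p) hann a d y * cos (2 * pi * (c p + k p * y))).
    apply: is_derive_sum_seq => p /kd pk.
    have u0 : 0 < d^-1 by rewrite invr_gt0.
    have k2 : `|k p| ^+ 2 = k p ^+ 2 by rewrite real_normK ?num_real.
    have ku : 4 * d^-1 ^+ 2 <= k p ^+ 2 by rewrite -k2; nra.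
    apply: is_derive_hann_prim; apply: contraTneq ku => ?; rewrite -ltNge; nra.
  have h2 := is_derive_hann_int a y (lt0r_neq0 d0).
  rewrite /H /h /P; apply: is_derive_eq.
  rewrite /GRing.scale /= -mulr_sumr; ring.
- apply: (measurableT_comp (f := @powR R ^~ (2 * s))); first exact: measurable_powR.
  apply: (measurableT_comp (f := fun z : R * R => normc (S2 z N)) (g := fun y : R => (x1, y))).
    exact: measurable_normc_S2.
  exact: measurable_pair1.
- by move=> y; exact: powR_ge0.
- move=> y; have /andP[w0 w2] := hann_bounds a d y.
  have SP : P y <= normc (S2 (x1, y) N) ^+ 2.
    rewrite PE; exact: (normc_S2_sqr_ge x1 y N (fun n => (2 * n.+1 <= N)%N)).
  have := LP (normc (S2 (x1, y) N)); rewrite normc_ge0 normc_S2_le => /(_ isT).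
  have f0 := powR_ge0 (normc (S2 (x1, y) N)) (2 * s).
  move: (normc _ ^+ 2) SP (_ `^ _) f0 => t SP f f0 Lf; rewrite /h.
  (* If the bracket is nonpositive, so is the minorant; otherwise the window may be replaced by 2
     and [P y] by |S2|^2. *)
  have [tn|tp] := leP (P y - N%:R / 8) 0.
    apply: le_trans f0; rewrite mulr_ge0_le0 ?divr_ge0 //.
    by rewrite mulr_ge0_le0.
  apply: le_trans Lf.
  have -> : L * (t - N%:R / 8) = L / 2 * (2 * (t - N%:R / 8)) by field.
  rewrite ler_wpM2l ?divr_ge0 //; nra.
- rewrite /H -mulrBr.
  have -> : forall A B C E F : R, A + C * E - (B + C * F) = (A - B) + C * (E - F) by move=> *; ring.
  rewrite hann_int_diff ?gt_eqF // -sumrB.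
  have off_le : \sum_(p | off p) - (d * k p ^+ 2)^-1 <=
     \sum_(p | off p) (hann_prim a d (c p) (k p) (a + d) - hann_prim a d (c p) (k p) a).
    apply: ler_sum => p /kd pk; have := hann_prim_diff_le a (c p) d0 pk.
    by rewrite ler_norml => /andP[].
  have : \sum_(p | off p) - (d * k p ^+ 2)^-1 = - (d^-1 * \sum_(p | off p) (k p ^+ 2)^-1).
    by rewrite sumrN mulr_sumr; congr (- _); apply: eq_bigr => p _; rewrite invfM.
  have so := sum_far_offdiag_le R N0n.
  have : d^-1 * \sum_(p | off p) (k p ^+ 2)^-1 <= d^-1 * (16 / N%:R).
    by rewrite ler_wpM2l // invr_ge0 ltW.
  have : d^-1 * (16 / N%:R) <= N%:R * d / 4.
    have -> : d^-1 * (16 / N%:R) = 16 / (d * N%:R) by rewrite invfM; ring.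
    rewrite ler_pdivrMr ?mulr_gt0 //; nra.
  move=> e1 e2 e3; rewrite e3 in off_le.
  rewrite [L * _](_ : _ = L / 2 * (N%:R * d / 8)); last by field.
  rewrite ler_wpM2l ?divr_ge0 //; nra.
Qed.

Lemma powRD_gt0 (R : realType) (x r s : R) : 0 < x -> x `^ (r + s) = x `^ r * x `^ s.
Proof. by move=> x0; rewrite powRD // (gt_eqF x0) implybT. Qed.

Lemma powR_subr1 (R : realType) (x s : R) : 0 < x -> x `^ s = x `^ (s - 1) * x.
Proof. by move=> x0; rewrite -[X in _ * X](powRr1 (ltW x0)) -powRD_gt0 // subrK. Qed.

Lemma I2_ge_inner (R : realType) (s delta l : R) (xi : R * R) (N : nat) :
  0 <= delta -> 0 <= l ->
  (forall x1, (l%:E <= \int[lebesgue_measure]_(y in `[xi.2, (xi.2 + delta)%R])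
     (normc (S2 (x1, y) N) `^ (2 * s))%:E)%E) ->
  ((l * delta)%:E <= I2 s delta xi N)%E.
Proof.
move=> d0 l0 hl.
pose A : set R := `[xi.1, xi.1 + delta]%classic.
pose B : set R := `[xi.2, xi.2 + delta]%classic.
pose f (x : R * R) := (normc (S2 x N) `^ (2 * s))%:E.
have mf : measurable_fun setT f by exact: measurable_I2_integrand.
have f0 x : (0 <= f x)%E by rewrite lee_fin powR_ge0.
have mB : measurable (box delta xi) by exact: measurable_box.
have mg : measurable_fun setT (f \_ (box delta xi)).
  apply/(measurable_restrictT _ mB); exact: measurable_funTS.
have g0 x : (0 <= (f \_ (box delta xi)) x)%E by rewrite /patch; case: ifP.
have -> : I2 s delta xi N = (\int[(@lebesgue_measure R \x @lebesgue_measure R)]_x (f \_ (box delta xi)) x)%E.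
  by rewrite /I2 integral_mkcond.
rewrite fubini_tonelli1 //; set F := fubini_F _ _.
have mF : measurable_fun setT F by exact: measurable_fun_fubini_tonelli_F.
have F0 x : (0 <= F x)%E by apply: integral_ge0.
apply: (@le_trans _ _ (\int[lebesgue_measure]_(x in A) l%:E)%E).
  rewrite integral_cst; last exact: measurable_itv.
  rewrite [X in (_ <= _ * X)%E](_ : _ = delta%:E); first by rewrite EFinM.
  exact: lebesgue_measure_segment.
apply: (@le_trans _ _ (\int[lebesgue_measure]_(x in A) F x)%E); last first.
  by apply: ge0_subset_integral => //; exact: measurable_itv.
apply: ge0_le_integral => //; first exact: measurable_itv.
  exact: measurable_funTS.
move=> x Ax; apply: le_trans (hl x) _.
have -> : F x = (\int[@lebesgue_measure R]_y (f \_ (box delta xi)) (x, y))%E by [].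
apply: (@le_trans _ _ (\int[lebesgue_measure]_(y in `[xi.2, (xi.2 + delta)%R])
    (f \_ (box delta xi)) (x, y))%E); last first.
  apply: ge0_subset_integral => //.
  apply: (measurableT_comp (f := f \_ (box delta xi)) (g := fun y : R => (x, y))) => //.
  exact: pair1_measurable.
rewrite le_eqVlt; apply/orP; left; apply/eqP; apply: eq_integral => y yB.
by rewrite /patch ifT // inE; split => //=; rewrite inE in yB; exact: yB.
Qed.

Lemma I2_ge_mean_square (R : realType) (s delta L : R) (xi : R * R) (N : nat) :
  0 < delta -> 8 <= delta * N%:R -> 0 <= L ->
  (forall t, 0 <= t <= N%:R -> L * (t ^+ 2 - N%:R / 8) <= t `^ (2 * s)) ->
  ((L * (N%:R * delta ^+ 2 / 16))%:E <= I2 s delta xi N)%E.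
Proof.
move=> d0 dN L0 LP.
have -> : L * (N%:R * delta ^+ 2 / 16) = L * (N%:R * delta / 16) * delta by ring.
apply: I2_ge_inner; first exact: ltW.
  by rewrite !mulr_ge0 // ltW.
by move=> x1; exact: inner_integral_ge.
Qed.

Lemma powR2M (R : realType) (t s : R) : 0 <= t -> t `^ (2 * s) = (t ^+ 2) `^ s.
Proof. by move=> t0; rewrite powRrM powR_mulrn. Qed.

(** The slope is L = (N/8)^(s-1): for t^2 > N/8 the power t^(2s) is at least L t^2, and for smaller
    t the affine bound is nonpositive. *)
Lemma I2_ge_mean_square_ge1 (R : realType) (s delta : R) (xi : R * R) (N : nat) :
  1 <= s -> 0 < delta -> 8 <= delta * N%:R ->
  (((8^-1 `^ (s - 1) / 16) * (delta ^+ 2 * N%:R `^ s))%:E <= I2 s delta xi N)%E.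
Proof.
move=> s1 d0 dN.
have N0 : 0 < N%:R :> R by rewrite -(pmulr_rgt0 _ d0); apply: lt_le_trans dN.
have := @I2_ge_mean_square R s delta ((N%:R / 8) `^ (s - 1)) xi N d0 dN (powR_ge0 _ _).
have -> : (N%:R / 8) `^ (s - 1) * (N%:R * delta ^+ 2 / 16) =
   8^-1 `^ (s - 1) / 16 * (delta ^+ 2 * N%:R `^ s).
  rewrite powRM ?invr_ge0 // ?ltW //.
  rewrite (powR_subr1 s N0).
  ring.
apply => t /andP[t0 tN]; rewrite powR2M //.
have [tA|At] := leP (t ^+ 2) (N%:R / 8).
  by apply: le_trans (powR_ge0 _ _); rewrite mulr_ge0_le0 ?powR_ge0 // subr_le0.
have A0 : 0 < N%:R / 8 :> R by rewrite divr_gt0.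
have T0 : 0 < t ^+ 2 by apply: lt_trans At.
rewrite (powR_subr1 s T0).
apply: (@le_trans _ _ ((N%:R / 8) `^ (s - 1) * t ^+ 2)).
  by rewrite ler_wpM2l ?powR_ge0 // gerBl ltW.
apply: ler_wpM2r; first exact: ltW.
by apply: ge0_ler_powR; rewrite ?nnegrE ?subr_ge0 // ltW.
Qed.

(** For s <= 1 the exponent 2(s-1) is nonpositive, so t <= N gives t^(2s) >= N^(2(s-1)) t^2. This
    yields the power N^(2s-1), at least N^(s-1). *)
Lemma I2_ge_mean_square_le1 (R : realType) (s delta : R) (xi : R * R) (N : nat) :
  0 < s -> s <= 1 -> 0 < delta -> 8 <= delta * N%:R ->
  ((16^-1 * (delta ^+ 2 * N%:R `^ (s - 1)))%:E <= I2 s delta xi N)%E.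
Proof.
move=> s0 s1 d0 dN.
have N0 : 0 < N%:R :> R by rewrite -(pmulr_rgt0 _ d0); apply: lt_le_trans dN.
have N1 : 1 <= N%:R :> R by rewrite ler1n; move: N0; rewrite ltr0n.
have := @I2_ge_mean_square R s delta (N%:R `^ (2 * (s - 1))) xi N d0 dN (powR_ge0 _ _).
move=> H; apply: le_trans (H _); last first.
  move=> t /andP[t0 tN].
  have [->|tn0] := eqVneq t 0.
    apply: le_trans (powR_ge0 _ _); rewrite mulr_ge0_le0 ?powR_ge0 //.
    by rewrite expr0n /= sub0r oppr_le0 divr_ge0.
  have t1 : 0 < t by rewrite lt_def tn0.
  have -> : t `^ (2 * s) = t `^ (2 * (s - 1)) * t ^+ 2.
    rewrite -powR_mulrn // -powRD_gt0 //; congr (_ `^ _); ring.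
  apply: (@le_trans _ _ (N%:R `^ (2 * (s - 1)) * t ^+ 2)).
    by rewrite ler_wpM2l ?powR_ge0 // gerBl divr_ge0.
  rewrite ler_wpM2r ?sqr_ge0 //.
  have -> : 2 * (s - 1) = - (2 * (1 - s)) by ring.
  rewrite !powRN lef_pV2 ?posrE ?powR_gt0 //.
  by apply: ge0_ler_powR; rewrite ?nnegrE ?mulr_ge0 ?subr_ge0.
rewrite lee_fin.
have -> : N%:R `^ (2 * (s - 1)) * (N%:R * delta ^+ 2 / 16) =
  16^-1 * (delta ^+ 2 * (N%:R `^ (2 * (s - 1)) * N%:R)) by ring.
rewrite ler_wpM2l // ler_wpM2l ?sqr_ge0 //.
rewrite -[X in _ <= _ * X](powRr1 (ltW N0)) -powRD_gt0 //.
apply: ler_powR => //; lra.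
Qed.

(** * A single rational point *)

Lemma ln_le_powR (R : realType) (x e : R) : 0 < e -> 1 <= x -> ln x <= x `^ e / e.
Proof.
move=> e0 x1; have x0 : 0 < x by lra.
rewrite ler_pdivlMr // mulrC -ln_powR.
have p0 : 0 < x `^ e by exact: powR_gt0.
have := @le_ln1Dx R (x `^ e - 1); rewrite [1 + _]addrC subrK => h.
have : -1 < x `^ e - 1 by lra.
by move=> /h; lra.
Qed.

Lemma exists_powR_gt (R : realType) (e C : R) : 0 < e ->
  exists N0 : nat, forall N : nat, (N0 <= N)%N -> C <= N%:R `^ e.
Proof.
move=> e0; pose K := Num.max C 1.
have K0 : 0 < K by rewrite lt_max ltr01 orbT.
exists (Num.truncn (K `^ e^-1)).+1 => N hN.
have h : K `^ e^-1 <= N%:R.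
  apply: ltW; apply: lt_le_trans (truncnS_gt _) _; by rewrite ler_nat.
apply: (@le_trans _ _ K); first by rewrite le_max lexx.
have -> : K = (K `^ e^-1) `^ e by rewrite -powRrM mulVf ?gt_eqF // powRr1 // ltW.
by apply: ge0_ler_powR; rewrite ?nnegrE ?powR_ge0 ?ler0n // ltW.
Qed.

(** Take q a power of 3: being prime to q then means not being divisible by 3, and of two
    consecutive integers at least one qualifies. *)
Lemma exists_dense_coprime (R : realType) (x : R) : 1 <= x ->
  exists q : nat, [/\ (0 < q)%N, odd q, x <= q%:R <= 3 * x &
    forall y : R, 0 <= y -> exists a : nat, coprime a q /\ y <= a%:R <= y + 2].
Proof.
move=> x1; pose n := Num.truncn x.
have x0 : 0 <= x by lra.
have /andP[nx xn] := truncn_itv x0; rewrite -/n in nx xn.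
have h1 : (n.+1 <= 3 ^ up_log 3 n.+1)%N by exact: up_logP.
have n1 : (0 < n)%N by rewrite lt0n; apply: contraTneq x1 => n0; rewrite -ltNge; move: xn; rewrite n0.
have h3 : (3 ^ up_log 3 n.+1 <= 3 * n)%N.
  have := @up_log_bounds 3 n.+1 isT; rewrite ltnS => /(_ n1) /andP[h2 _].
  have : (0 < up_log 3 n.+1)%N by rewrite up_log_gt0.
  by move: h2; case: (up_log 3 n.+1) => [|k] //= h2 _; rewrite expnS; lia.
exists (3 ^ up_log 3 n.+1)%N; split.
- by rewrite expn_gt0.
- by rewrite oddX orbT.
- apply/andP; split; first by apply: ltW; apply: lt_le_trans xn _; rewrite ler_nat.
  apply: (@le_trans _ _ (3 * n%:R)); first by rewrite -natrM ler_nat.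
  by rewrite ler_wpM2l.
move=> y y0; have /andP[my ym] := truncn_itv y0.
move: (Num.truncn y) my ym => m my ym.
have ym' : y <= m.+1%:R by exact: ltW.
have [h|h] := boolP (3 %| m.+1)%N.
  exists m.+2; split; last by rewrite -[m.+2%:R]natr1 -[m.+1%:R]natr1 in ym' *; lra.
  by apply: coprimeXr; rewrite coprime_sym prime_coprime //; move: h; lia.
exists m.+1; split; last by rewrite ym' -natr1; lra.
by apply: coprimeXr; rewrite coprime_sym prime_coprime.
Qed.

(** Since ln q <= q^eta / eta, the quantity q (5 + 4 ln q) is of order q^(1+eta), hence at most a
    constant times N^(1-eta^2). The spare factor N^(eta^2) absorbs all constants, collected in
    [D]. *)
Lemma gauss_tail_cond (R : realType) (eta C : R) : 0 < eta -> eta <= 2^-1 -> 0 < C ->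
  exists N0 : nat, forall N q : nat, (N0 <= N)%N -> (0 < q)%N ->
    q%:R <= C * N%:R `^ (1 - eta) ->
    (8 * q <= N)%N /\ Num.sqrt q%:R * (5 + 4 * ln q%:R) <= N%:R / (8 * Num.sqrt q%:R) :> R.
Proof.
move=> e0 e1 C0.
pose D := 8 * C + 1 + 8 * (5 + 4 / eta) * C `^ (1 + eta).
have e2 : 0 < eta ^+ 2 by rewrite exprn_gt0.
have [N0 hN0] := exists_powR_gt D e2.
have D1 : 1 <= D.
  rewrite /D; have : 0 <= 8 * (5 + 4 / eta) * C `^ (1 + eta).
    by rewrite mulr_ge0 ?powR_ge0 // mulr_ge0 // addr_ge0 // divr_ge0 // ltW.
  lra.
exists (maxn N0 1) => N q; rewrite geq_max => /andP[hN N1] q0 qN.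
have N1R : 1 <= N%:R :> R by rewrite ler1n.
have N0R : 0 < N%:R :> R by lra.
have DN := hN0 N hN.
have q1R : 1 <= q%:R :> R by rewrite ler1n.
have q0R : 0 < q%:R :> R by lra.
have DC : 8 * C <= D /\ 8 * (5 + 4 / eta) * C `^ (1 + eta) <= D.
  have : 0 <= 8 * (5 + 4 / eta) * C `^ (1 + eta).
    by rewrite mulr_ge0 ?powR_ge0 // mulr_ge0 // addr_ge0 // divr_ge0 // ltW.
  rewrite /D; split; lra.
have [DC1 DC2] := DC.
split.
  rewrite -(ler_nat R) natrM.
  have -> : N%:R = N%:R `^ (1 - eta) * N%:R `^ eta :> R.
    by rewrite -powRD_gt0 // subrK powRr1 // ltW.
  have : N%:R `^ (eta ^+ 2) <= N%:R `^ eta :> R by apply: ler_powR => //; nra.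
  have := powR_gt0 (1 - eta) N0R; nra.
have w0 : 0 < Num.sqrt q%:R :> R by rewrite sqrtr_gt0.
have w2 : Num.sqrt q%:R ^+ 2 = q%:R :> R by rewrite sqr_sqrtr ?ler0n.
rewrite ler_pdivlMr ?mulr_gt0 //.
set w := Num.sqrt _ in w0 w2 *.
have -> : w * (5 + 4 * ln q%:R) * (8 * w) =
   8 * (q%:R * (5 + 4 * ln q%:R)) :> R by rewrite -w2; ring.
have lnq := ln_le_powR e0 q1R.
have qe1 : 1 <= q%:R `^ eta :> R by have := ler_powR q1R (ltW e0); rewrite powRr0.
have h1 : 5 + 4 * ln q%:R <= (5 + 4 / eta) * q%:R `^ eta.
  have -> : (5 + 4 / eta) * q%:R `^ eta = 5 * q%:R `^ eta + 4 * (q%:R `^ eta / eta).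
    by ring.
  lra.
have h2 : q%:R * (5 + 4 * ln q%:R) <= (5 + 4 / eta) * q%:R `^ (1 + eta).
  rewrite powRD_gt0 // (powRr1 (ltW q0R)).
  have := ler_wpM2l (ltW q0R) h1; lra.
have h3 : q%:R `^ (1 + eta) <= C `^ (1 + eta) * N%:R `^ (1 - eta ^+ 2).
  have -> : 1 - eta ^+ 2 = (1 - eta) * (1 + eta) by ring.
  rewrite powRrM -powRM ?powR_ge0 ?(ltW C0) //.
  by apply: ge0_ler_powR; rewrite ?nnegrE ?mulr_ge0 ?powR_ge0 ?addr_ge0 // ltW.
have f0 : 0 < 5 + 4 / eta by rewrite addr_gt0 // divr_gt0.
have h4 := ler_wpM2l (ltW f0) h3.
have -> : N%:R = N%:R `^ (1 - eta ^+ 2) * N%:R `^ (eta ^+ 2) :> R.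
  by rewrite -powRD_gt0 // subrK powRr1 // ltW.
have Z0 := powR_gt0 (1 - eta ^+ 2) N0R.
move: (N%:R `^ (1 - eta ^+ 2)) (N%:R `^ (eta ^+ 2)) Z0 DN h4 => Z W Z0 DN h4.
have : 8 * (5 + 4 / eta) * C `^ (1 + eta) * Z <= W * Z by rewrite ler_wpM2r //; lra.
have := le_trans h2 h4; lra.
Qed.

(** One rectangle around a point with odd denominator q between 4/delta and 12/delta. There |S2|^2
    >= N^2/(4q) >= delta N^2/48, and the area is [arc_eps R ^+ 2] / N^3. *)
Lemma I2_ge_major_arc (R : realType) (s eta : R) : 0 < s -> 0 < eta -> eta <= 2^-1 ->
  exists c : R, 0 < c /\ exists N0 : nat, forall N : nat, (N0 <= N)%N ->
  forall (delta : R) (xi : R * R), 0 <= xi.1 -> 0 <= xi.2 ->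
  N%:R `^ eta <= delta * N%:R -> delta <= 1 ->
  ((c * (delta `^ s * N%:R `^ (2 * s - 3)))%:E <= I2 s delta xi N)%E.
Proof.
move=> s0 e0 e1.
have h12 : 0 < 12 :> R by rewrite ltr0n.
have [N0 hN0] := gauss_tail_cond e0 e1 h12.
pose c : R := (48^-1) `^ s * (arc_eps R * arc_eps R).
have a0 := arc_eps_gt0 R; have a1 := arc_eps_le1 R.
exists c; split; first by rewrite !mulr_gt0 // powR_gt0 // invr_gt0.
exists (maxn N0 1) => N; rewrite geq_max => /andP[hN N1] delta xi xi1 xi2 dN d1.
have N1R : 1 <= N%:R :> R by rewrite ler1n.
have N0R : 0 < N%:R :> R by lra.
have d0 : 0 < delta.
  by rewrite -(pmulr_lgt0 _ N0R); apply: lt_le_trans dN; exact: powR_gt0.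
(* With delta q >= 4, a numerator at most 2 above q xi leaves room for the arc, whose sides are at
   most 1/q. *)
have d4 : 1 <= 4 / delta by rewrite ler_pdivlMr //; lra.
have [q [q0 oq /andP[qk1 qk2] dense]] := exists_dense_coprime d4.
have q0R : 0 < q%:R :> R by rewrite ltr0n.
have qN : q%:R <= 12 * N%:R `^ (1 - eta).
  apply: le_trans qk2 _; rewrite mulrA ler_pdivrMr //.
  suff : 1 <= N%:R `^ (1 - eta) * delta by lra.
  rewrite powRD_gt0 // powRN (powRr1 (ltW N0R)).
  by rewrite mulrAC ler_pdivlMr ?powR_gt0 // mul1r mulrC.
have [q8 tail] := hN0 N q hN q0 qN.
have qxi (x : R) : 0 <= x -> 0 <= q%:R * x by move=> ?; rewrite mulr_ge0 // ltW.
have [a2 [cop /andP[a21 a22]]] := dense _ (qxi _ xi2).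
have [b1 [_ /andP[a11 a12]]] := dense _ (qxi _ xi1).
have dq : 4 <= delta * q%:R by move: qk1; rewrite ler_pdivrMr // mulrC.
have q1N : 8 * q%:R <= N%:R :> R by rewrite -natrM ler_nat.
set w : R := arc_eps R / N%:R; set h : R := arc_eps R / N%:R ^+ 2.
have w0 : 0 < w by rewrite divr_gt0.
have h0 : 0 < h by rewrite divr_gt0 ?exprn_gt0.
have hw : h <= w.
  have -> : h = w / N%:R by rewrite /h /w expr2 invfM mulrA.
  by rewrite ler_pdivrMr // ler_peMr // ltW.
have wq : w * q%:R <= 1.
  have : arc_eps R * q%:R <= q%:R by rewrite ler_piMl // ltW.
  by rewrite /w mulrAC ler_pdivrMr // mul1r; lra.
have hq : h * q%:R <= 1 by apply: le_trans wq; apply: ler_wpM2r; rewrite ?ler0n.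
pose v : R := N%:R / (2 * Num.sqrt q%:R).
have sq0 : 0 < Num.sqrt q%:R :> R by rewrite sqrtr_gt0.
have vv : 48^-1 * (delta * N%:R ^+ 2) <= v ^+ 2.
  rewrite /v expr_div_n exprMn sqr_sqrtr ?ler0n // ler_pdivlMr ?mulr_gt0 //.
  have : delta * q%:R <= 12.
    by rewrite mulrC -ler_pdivlMr //; lra.
  have : 0 < N%:R ^+ 2 :> R by rewrite exprn_gt0.
  nra.
have v0 : 0 <= v by rewrite /v divr_ge0 // ltW // mulr_gt0.
have := @I2_ge_rectangles R s delta xi N 1 (fun=> (b1%:R / q%:R, a2%:R / q%:R)) w h v s0 w0 h0.
move=> /(_ _ _ _ _ _) H; apply: le_trans (H _ _ _ _ _); last first.
- move=> _ t1 t2 hb1 hb2; apply: S2_near_rational => //; first by rewrite oq.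
  by move=> r rq; apply: le_trans tail; exact: gauss_tail_le.
- by move=> i j; rewrite !ord1 eqxx.
- move=> _ /=; split; first by rewrite ler_pdivlMr // mulrC.
  rewrite -(ler_pM2r q0R) mulrDl divfK ?gt_eqF //; clearbody w h; clear v vv v0 H; lra.
- move=> _ /=; split; first by rewrite ler_pdivlMr // mulrC.
  rewrite -(ler_pM2r q0R) mulrDl divfK ?gt_eqF //; clearbody w h; clear v vv v0 H; lra.
- exact: v0.
rewrite lee_fin mul1r.
clear H.
have vs : (48^-1) `^ s * (delta `^ s * N%:R `^ (2 * s)) <= v `^ (2 * s).
  rewrite (powR2M s v0) (powR2M s (ltW N0R)) -powRM ?sqr_ge0 ?(ltW d0) //.
  rewrite -powRM ?invr_ge0 ?mulr_ge0 ?sqr_ge0 ?(ltW d0) //.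
  by apply: ge0_ler_powR; rewrite ?nnegrE ?mulr_ge0 ?invr_ge0 ?sqr_ge0 // ltW.
have -> : c * (delta `^ s * N%:R `^ (2 * s - 3)) =
   (48^-1 `^ s * (delta `^ s * N%:R `^ (2 * s))) * (w * h).
  rewrite powRD_gt0 // powRN (powR_mulrn 3 (ltW N0R)) /c /w /h.
  by field; rewrite gt_eqF.
by rewrite ler_wpM2r // mulr_ge0 // ltW.
Qed.

(** * Counting reduced fractions *)

(** Pigeonhole: the fractional parts of j x for the Q + 1 values j = 0, ..., Q fall into Q boxes of
    length 1/Q. *)
Lemma dirichlet_approx (R : realType) (x : R) (Q : nat) : (0 < Q)%N -> 0 <= x ->
  exists a q : nat, [/\ (0 < q <= Q)%N, coprime a q & `|q%:R * x - a%:R| <= Q%:R^-1].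
Proof.
move=> Q0 x0; have QR : 0 < Q%:R :> R by rewrite ltr0n.
pose fr (j : nat) : R := j%:R * x - (Num.truncn (j%:R * x))%:R.
have fr_itv j : 0 <= fr j < 1.
  have /andP[h1 h2] := truncn_itv (mulr_ge0 (ler0n R j) x0).
  by rewrite /fr subr_ge0 h1 ltrBlDr addrC natr1.
pose g j := Num.truncn (Q%:R * fr j).
have g_itv j : (g j)%:R <= Q%:R * fr j < (g j).+1%:R.
  by apply: truncn_itv; rewrite mulr_ge0 //; have /andP[] := fr_itv j.
have gQ j : (g j < Q)%N.
  rewrite -(ltr_nat R); have /andP[h _] := g_itv j; apply: le_lt_trans h _.
  by rewrite gtr_pMr //; have /andP[] := fr_itv j.
have [/injectiveP inj|] := boolP (injectiveb (fun j : 'I_Q.+1 => Ordinal (gQ j))).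
  by have := leq_card _ inj; rewrite !card_ord ltnn.
move=> /injectivePn[i [j ij [gij]]].
wlog lij : i j ij gij / (i < j)%N.
  move=> H; have [l|l|e] := ltngtP i j; first exact: (H i j).
    by apply: (H j i) => //; rewrite eq_sym.
  by move: ij; rewrite -val_eqE /= e eqxx.
pose q := (j - i)%N; pose a := (Num.truncn (j%:R * x) - Num.truncn (i%:R * x))%N.
have q0 : (0 < q)%N by rewrite subn_gt0.
have aE : a%:R = (Num.truncn (j%:R * x))%:R - (Num.truncn (i%:R * x))%:R :> R.
  rewrite /a natrB //; apply: le_truncn; rewrite ler_wpM2r // ler_nat; exact: ltnW.
have qx : `|q%:R * x - a%:R| <= Q%:R^-1.
  have -> : q%:R * x - a%:R = fr j - fr i.
    by rewrite aE /fr /q natrB ?(ltnW lij) //; ring.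
  rewrite -(ler_pM2l QR) mulfV ?gt_eqF // -{1}(ger0_norm (ltW QR)) -normrM mulrBr.
  have /andP[] := g_itv i; have /andP[] := g_itv j.
  rewrite gij -[(g j).+1%:R]natr1 ler_norml => h1 h2 h3 h4; apply/andP; split; lra.
(* Dividing by the gcd makes the fraction reduced and divides the error by d. *)
pose d := gcdn a q.
have d0 : (0 < d)%N by rewrite gcdn_gt0 q0 orbT.
exists (a %/ d)%N, (q %/ d)%N; split.
- rewrite divn_gt0 // dvdn_leq ?dvdn_gcdr //=.
  by rewrite (leq_trans (leq_div _ _)) // /q (leq_trans (leq_subr _ _)) // -ltnS.
- rewrite /coprime -(eqn_pmul2r d0) mul1n muln_gcdl !divnK ?dvdn_gcdl ?dvdn_gcdr //.
apply: le_trans qx; have dR : 1 <= d%:R :> R by rewrite ler1n.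
have -> : q%:R * x - a%:R = d%:R * ((q %/ d)%N%:R * x - (a %/ d)%N%:R).
  rewrite mulrBr mulrA -!natrM [(d * _)%N]mulnC [(d * (a %/ d))%N]mulnC.
  by rewrite !divnK ?dvdn_gcdl ?dvdn_gcdr.
by rewrite normrM ger0_norm // ler_peMl.
Qed.

(** The difference has numerator a q' - a' q. If this integer vanishes, q and q' divide each other
    by coprimality, and the fractions have the same numerator and denominator. *)
Lemma reduced_fraction_gap (R : realType) (a q a' q' : nat) :
  (0 < q)%N -> (0 < q')%N -> coprime a q -> coprime a' q' -> (q, a) != (q', a') ->
  (q%:R * q'%:R)^-1 <= `|a%:R / q%:R - a'%:R / q'%:R| :> R.
Proof.
move=> q0 q'0 cq cq' ne.
have qR : 0 < q%:R :> R by rewrite ltr0n.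
have q'R : 0 < q'%:R :> R by rewrite ltr0n.
have -> : a%:R / q%:R - a'%:R / q'%:R = ((a * q')%N%:R - (a' * q)%N%:R) / (q%:R * q'%:R) :> R.
  by rewrite !natrM; field; rewrite !gt_eqF.
rewrite normrM normfV (ger0_norm (ltW (mulr_gt0 qR q'R))).
apply: ler_peMl; first by rewrite invr_ge0 mulr_ge0.
have [e|l|l] := ltngtP (a * q')%N (a' * q)%N.
- by rewrite distrC -natrB ?(ltnW e) // ger0_norm // ler1n subn_gt0.
- by rewrite -natrB ?(ltnW l) // ger0_norm // ler1n subn_gt0.
exfalso; move/eqP: ne; apply.
have d1 : (q %| q')%N.
  by rewrite -(@Gauss_dvdr q a) 1?coprime_sym // l dvdn_mull.
have d2 : (q' %| q)%N.
  by rewrite -(@Gauss_dvdr q' a') 1?coprime_sym // -l dvdn_mull.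
have qq : q = q' by apply/eqP; rewrite eqn_dvd d1 d2.
by move: l; rewrite qq => /eqP; rewrite eqn_pmul2r // => /eqP ->.
Qed.

Lemma measure_bigsetU_le (R : realType) (d : measure_display) (T : measurableType d)
    (mu : {measure set T -> \bar R}) (I : Type) (r : seq I) (P : pred I)
    (A : I -> set T) : (forall i, measurable (A i)) ->
  (mu (\big[setU/set0]_(i <- r | P i) A i) <= \sum_(i <- r | P i) mu (A i))%E.
Proof.
move=> mA; elim: r => [|i r IH]; first by rewrite !big_nil measure0.
rewrite !big_cons; case: ifP => // _.
have mU : measurable (\big[setU/set0]_(j <- r | P j) A j).
  by apply: bigsetU_measurable => j _.
apply: le_trans (measureU2 _ (mA i) mU) _.
by rewrite leeD2l.
Qed.

Lemma lebesgue_measure_half_open (R : realType) (c r : R) : 0 < r ->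
  @lebesgue_measure R `[c - r, c + r[%classic = (2 * r)%:E.
Proof.
move=> r0; rewrite lebesgue_measure_itv /= lte_fin ifT; last by lra.
by rewrite -EFinB; congr EFin; ring.
Qed.

Lemma cover_length_le (R : realType) (I : finType) (P : pred I) (c r : I -> R) (x y : R) :
  (forall i, 0 <= r i) ->
  (forall z, x <= z <= y -> exists2 i, P i & `|z - c i| <= r i) ->
  y - x <= \sum_(i | P i) 2 * r i.
Proof.
move=> r0 cov.
have [xy|yx] := leP x y; last first.
  apply: (@le_trans _ _ 0); first by lra.
  by apply: sumr_ge0 => i _; rewrite mulr_ge0.
pose A i : set R := `[c i - r i, c i - r i + 2 * r i]%classic.
have mA i : measurable (A i) by exact: measurable_itv.
have sub : `[x, y]%classic `<=` \big[setU/set0]_(i | P i) A i.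
  move=> z; rewrite /= in_itv /= => /cov[i Pi]; rewrite ler_norml => /andP[z1 z2].
  rewrite (bigD1 i) //=; left.
  by rewrite /A /= in_itv /=; apply/andP; split; lra.
have H := @measure_bigsetU_le R _ _ (@lebesgue_measure R) I (index_enum I) P A
  (fun i => measurable_itv _).
have mU : measurable (\big[setU/set0]_(i | P i) A i : set (g_sigma_algebraType (R.-ocitv.-measurable))).
  by apply: bigsetU_measurable => i _; exact: measurable_itv.
have : (lebesgue_measure `[x, y]%classic <= lebesgue_measure (\big[setU/set0]_(i | P i) A i))%E.
  by apply: le_measure; rewrite ?inE //; exact: measurable_itv.
move=> /le_trans /(_ H); have -> : y = x + (y - x) by ring.
rewrite lebesgue_measure_segment; last by lra.
rewrite (eq_bigr (fun i => (2 * r i)%:E)); last first.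
  by move=> i _; apply: lebesgue_measure_segment; rewrite mulr_ge0.
by rewrite sumEFin lee_fin (addrC x) addrK.
Qed.

(** Half-open intervals are used so that the nonstrict separation, under which intervals may touch,
    still gives disjointness. *)
Lemma packing_length_le (R : realType) (I : finType) (A : {set I}) (c r : I -> R) (x y : R) :
  x <= y ->
  (forall i, i \in A -> 0 < r i /\ x <= c i - r i /\ c i + r i <= y) ->
  (forall i j, i \in A -> j \in A -> i != j -> r i + r j <= `|c i - c j|) ->
  \sum_(i in A) 2 * r i <= y - x.
Proof.
move=> xy inA sep; rewrite big_enum_val.
pose B (i : 'I_#|A|) : set R := `[c (enum_val i) - r (enum_val i), c (enum_val i) + r (enum_val i)[%classic.
have mB i : measurable (B i) by exact: measurable_itv.
have tB : trivIset setT B.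
  move=> i j _ _ [z []]; rewrite /B /= !in_itv /= => /andP[z1 z2] /andP[z3 z4].
  apply/eqP/negPn/negP => ij.
  have := sep _ _ (enum_valP i) (enum_valP j); rewrite (inj_eq enum_val_inj) => /(_ ij).
  by rewrite leNgt ltr_norml => /negP; apply; apply/andP; split; lra.
have := @measure_bigsetU_ord _ _ _ (@lebesgue_measure R) #|A| predT B mB tB.
have sub : (\big[setU/set0]_(i < #|A|) B i) `<=` `[x, y]%classic.
  move=> z; elim/big_ind: _ => [|C D HC HD|i _]; [by []|by move=> [/HC|/HD]|].
  rewrite /B /= !in_itv /= => /andP[z1 z2].
  by have [_ [h1 h2]] := inA _ (enum_valP i); apply/andP; split; lra.
have : (lebesgue_measure (\big[setU/set0]_(i < #|A|) B i) <= (y - x)%:E)%E.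
  rewrite -(@lebesgue_measure_segment R x (y - x)) ?subr_ge0 // addrC subrK.
  have mU : measurable (\big[setU/set0]_(i < #|A|) B i : set (g_sigma_algebraType (R.-ocitv.-measurable))).
    by apply: bigsetU_measurable => i _; exact: measurable_itv.
  by apply: le_measure; rewrite ?inE //; exact: measurable_itv.
move=> h e; rewrite e in h.
rewrite (eq_bigr (fun i => (2 * r (enum_val i))%:E)) in h.
  by rewrite sumEFin lee_fin in h.
move=> i _; apply: lebesgue_measure_half_open.
by have [] := inA _ (enum_valP i).
Qed.

(** The pair is (denominator, numerator), with [K] bounding numerators to keep the type finite. The
    margin 1/Q leaves room for the arc attached to the fraction. *)
Definition reduced_in (R : realType) (Q K : nat) (xi d : R) (p : 'I_Q.+1 * 'I_K) : bool :=
  [&& (0 < p.1)%N, coprime p.2 p.1, xi + Q%:R^-1 <= p.2%:R / p.1%:R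
    & p.2%:R / p.1%:R <= xi + d - Q%:R^-1].

(** With u = 1/Q, the arcs of radius u/q have total length at least d - 4u. Those with q <= Q/8
    account for at most (d + 6u)/4, a quarter of a packing. As d >= 24u, the others keep at least
    d/2, each being of length at most 16 u^2. *)
Lemma card_reduced_fractions_ge (R : realType) (Q : nat) (xi d : R) :
  (0 < Q)%N -> 0 <= xi -> 24 <= d * Q%:R ->
  exists K : nat,
   d * Q%:R ^+ 2 / 32 <=
   #|[set p : 'I_Q.+1 * 'I_K | reduced_in xi d p && (Q < 8 * p.1)%N]%SET|%:R.
Proof.
move=> Q0 xi0 dQ; have QR : 0 < Q%:R :> R by rewrite ltr0n.
have d0 : 0 < d.
  by rewrite -(pmulr_lgt0 _ QR); apply: lt_le_trans dQ; rewrite ltr0n.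
set u : R := Q%:R^-1; have u0 : 0 < u by rewrite invr_gt0.
have uQ : u * Q%:R = 1 by rewrite /u mulVf // gt_eqF.
have du : 24 * u <= d.
  by rewrite -(ler_pM2r QR) -mulrA uQ mulr1.
pose K := (Num.truncn (Q%:R * (xi + d))).+1; exists K.
pose T : finType := ('I_Q.+1 * 'I_K)%type.
pose P (p : T) := reduced_in xi d p.
pose c (p : T) : R := p.2%:R / p.1%:R.
(* Dirichlet moves a point by at most u, so points 2u away from the ends are approximated by
   fractions respecting the margin u. *)
have cov z : xi + 2 * u <= z <= xi + d - 2 * u ->
    exists2 p : T, P p & `|z - c p| <= u / p.1%:R.
  move=> /andP[z1 z2]; have z0 : 0 <= z by lra.
  have [a [q [/andP[q0 qQ] cop qz]]] := dirichlet_approx Q0 z0.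
  have qR : 1 <= q%:R :> R by rewrite ler1n.
  have qR0 : 0 < q%:R :> R by lra.
  have ca : `|z - a%:R / q%:R| <= u / q%:R.
    rewrite ler_pdivlMr // -{2}(ger0_norm (ltW qR0)) -normrM mulrBl divfK ?gt_eqF //.
    by rewrite mulrC.
  have uq : u / q%:R <= u by rewrite ler_pdivrMr // ler_peMr // ltW.
  have := ca; rewrite ler_norml => /andP[c1 c2].
  have aK : (a < K)%N.
    rewrite -(ltr_nat R); apply: le_lt_trans (truncnS_gt _).
    have : a%:R / q%:R <= xi + d by lra.
    rewrite ler_pdivrMr // => h; apply: (le_trans h); rewrite mulrC ler_wpM2r ?ler_nat //; lra.
  exists (Ordinal (qQ : (q < Q.+1)%N), Ordinal aK) => //.
  rewrite /P /reduced_in /= q0 cop /= -/u; apply/andP; split; lra.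
have total := cover_length_le (P := P) (c := c) (r := fun p => u / p.1%:R)
  (fun p => divr_ge0 (ltW u0) (ler0n R p.1)) cov.
pose B := [set p : T | P p && (8 * p.1 <= Q)%N]%SET.
(* The enlarged radii are at most 4u around centres at distance at least u from the ends, hence the
   overhang 3u. Disjointness amounts to 4 q + 4 q' <= Q. *)
have Bsum : \sum_(p in B) 2 * (4 * u / p.1%:R) <= (xi + d + 3 * u) - (xi - 3 * u).
  apply: (@packing_length_le R T B c (fun p => 4 * u / p.1%:R)); first by lra.
    move=> p; rewrite inE => /andP[/and4P[p0 _ p1 p2] _].
    have pR : 1 <= p.1%:R :> R by rewrite ler1n.
    have pR0 : 0 < p.1%:R :> R by lra.
    have h : 4 * u / p.1%:R <= 4 * u by rewrite ler_pdivrMr // ler_peMr // mulr_ge0 // ltW.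
    rewrite -/u in p1 p2; rewrite -/(c p) in p1 p2.
    split; first by rewrite divr_gt0 // mulr_gt0.
    by split; lra.
  move=> p p'; rewrite !inE => /andP[/and4P[p0 pc _ _] p8] /andP[/and4P[p'0 pc' _ _] p8'] ne.
  have ne' : (nat_of_ord p.1, nat_of_ord p.2) != (nat_of_ord p'.1, nat_of_ord p'.2).
    by apply: contraNneq ne => -[/ord_inj e1 /ord_inj e2]; apply/eqP; case: p p' e1 e2 {p0 pc p8 p'0 pc' p8'} => [? ?] [? ?] /= -> ->.
  have := reduced_fraction_gap R p0 p'0 pc pc' ne'; apply: le_trans.
  have pR : 0 < p.1%:R :> R by rewrite ltr0n.
  have pR' : 0 < p'.1%:R :> R by rewrite ltr0n.
  have -> : 4 * u / p.1%:R + 4 * u / p'.1%:R = (4 * p.1%:R + 4 * p'.1%:R) / Q%:R * (p.1%:R * p'.1%:R)^-1.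
    by rewrite /u; field; rewrite !gt_eqF.
  apply: ler_piMl; first by rewrite invr_ge0 mulr_ge0.
  rewrite ler_pdivrMr // mul1r.
  have : 8 * p.1%:R <= Q%:R :> R by rewrite -natrM ler_nat.
  have : 8 * p'.1%:R <= Q%:R :> R by rewrite -natrM ler_nat.
  lra.
set G := finset _.
have Gsum : \sum_(p in G) 2 * (u / p.1%:R) <= #|G|%:R * (16 * u ^+ 2).
  rewrite -sum1_card natr_sum mulr_suml; apply: ler_sum => p; rewrite inE => /andP[/andP[p0 _] p8].
  have pR : 0 < p.1%:R :> R by rewrite ltr0n.
  have h : Q%:R <= 8 * p.1%:R :> R by rewrite -natrM ler_nat ltnW.
  rewrite mul1r mulrA ler_pdivrMr //.
  have -> : 16 * u ^+ 2 * p.1%:R = 2 * u * (u * (8 * p.1%:R)) by ring.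
  rewrite ler_peMr ?mulr_ge0 ?(ltW u0) //.
  have : u * Q%:R <= u * (8 * p.1%:R) by rewrite ler_pM2l.
  by rewrite uQ.
have split_sum : \sum_(p | P p) 2 * (u / p.1%:R) =
    4^-1 * \sum_(p in B) 2 * (4 * u / p.1%:R) + \sum_(p in G) 2 * (u / p.1%:R).
  rewrite (bigID (fun p : T => (8 * p.1 <= Q)%N)) /=; congr (_ + _).
    rewrite mulr_sumr; apply: eq_big => [p|p _]; first by rewrite inE.
    by rewrite -[4 * u / _]mulrA; lra.
  by apply: eq_bigl => p; rewrite inE -ltnNge.
rewrite split_sum in total.
have : d / 2 <= #|G|%:R * (16 * u ^+ 2) by lra.
have -> : 16 * u ^+ 2 = 16 / Q%:R ^+ 2 by rewrite /u exprVn.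
by rewrite mulrA ler_pdivlMr ?exprn_gt0 //; lra.
Qed.

(** * Many rational points *)

Lemma truncn_ge_half (R : realType) (x : R) : 1 <= x -> x / 2 <= (Num.truncn x)%:R.
Proof.
move=> x1; have x0 : 0 <= x by lra.
have /andP[_] := truncn_itv x0.
have : (0 < Num.truncn x)%N.
  by rewrite lt0n; apply: contraTneq x1 => n0; rewrite -ltNge; have /andP[_] := truncn_itv x0; rewrite n0.
by rewrite -(ler_nat R) -natr1; lra.
Qed.

(** Supplies numerators a1 meeting the parity condition of [S2_near_rational] for even q. *)
Definition next_parity (R : realType) (b : bool) (x : R) : nat :=
  let m := (Num.truncn x).+1 in if odd m == b then m else m.+1.

Lemma next_parityP (R : realType) (b : bool) (x : R) : 0 <= x ->
  odd (next_parity b x) = b /\ x <= (next_parity b x)%:R <= x + 2.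
Proof.
move=> /truncn_itv /andP[h1 h2]; rewrite /next_parity; case: ifP => e.
  by split; [exact/eqP | rewrite (ltW h2) -natr1; lra].
split; first by move: e => /=; case: (odd _); case: b.
by rewrite -natr1 -natr1 in h2 *; lra.
Qed.

(** At least delta Q^2 / 32 fractions a2/q, each with at least delta Q / 64 numerators a1, give the
    factor 2048. On each rectangle |S2|^2 >= N^2/(4q) >= N^2/(4Q). *)
Lemma I2_ge_many_arcs (R : realType) (s delta : R) (xi : R * R) (N Q : nat) :
  0 < s -> 0 <= xi.1 -> 0 <= xi.2 ->
  (0 < Q)%N -> 4 * Q%:R <= Num.sqrt N%:R :> R -> 64 <= delta * Q%:R ->
  (((N%:R ^+ 2 / (4 * Q%:R)) `^ s *
     (delta ^+ 2 * Q%:R ^+ 3 / 2048 * (arc_eps R ^+ 2 / N%:R ^+ 3)))%:E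
    <= I2 s delta xi N)%E.
Proof.
move=> s0 xi1 xi2 Q0 QN dQ.
have a0 := arc_eps_gt0 R; have a1 := arc_eps_le1 R.
have QR : 1 <= Q%:R :> R by rewrite ler1n.
have QR0 : 0 < Q%:R :> R by lra.
set rN := Num.sqrt N%:R in QN.
have rN2 : rN ^+ 2 = N%:R by rewrite sqr_sqrtr.
have rN4 : 4 <= rN by lra.
have NQ : 16 * Q%:R ^+ 2 <= N%:R :> R by rewrite -rN2; nra.
have NR : 16 <= N%:R :> R by nra.
have NR0 : 0 < N%:R :> R by lra.
have d0 : 0 < delta by rewrite -(pmulr_lgt0 _ QR0); apply: lt_le_trans dQ.
have dQ24 : 24 <= delta * Q%:R by lra.
have [K cardG] := card_reduced_fractions_ge Q0 xi2 dQ24.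
set G := finset _ in cardG.
(* [M] numerators a1 in steps of 2 occupy, with the initial offset and the arc, less than 2 M + 3 <=
   delta Q / 8 < delta q, so they fit in the first side. *)
pose M := Num.truncn (delta * Q%:R / 32).
have M1 : delta * Q%:R / 64 <= M%:R.
  have := @truncn_ge_half R (delta * Q%:R / 32); rewrite -/M.
  have : 1 <= delta * Q%:R / 32 by lra.
  by move=> h /(_ h); lra.
have M2 : 2 * M%:R + 3 <= delta * Q%:R / 8.
  have z0 : 0 <= delta * Q%:R / 32 by lra.
  by have /andP[] := truncn_itv z0; rewrite -/M; lra.
pose T : finType := (('I_Q.+1 * 'I_K) * 'I_M)%type.
pose A : {set T} := finset.setX G [set: 'I_M]%SET.
have cardA : #|A| = (#|G| * M)%N by rewrite cardsX cardsT card_ord.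
pose a (t : T) : nat := (next_parity (odd (t.1.1)./2) (t.1.1%:R * xi.1) + 2 * t.2)%N.
have aP (t : T) : odd (a t) = odd (t.1.1)./2 /\
    t.1.1%:R * xi.1 <= (a t)%:R <= t.1.1%:R * xi.1 + 2 + 2 * t.2%:R.
  have [] := @next_parityP R (odd (t.1.1)./2) (t.1.1%:R * xi.1).
    by rewrite mulr_ge0.
  move=> o /andP[l u]; rewrite /a oddD oddM addbF o natrD natrM; split => //.
  by have := ler0n R t.2; lra.
pose p (t : T) : R * R := ((a t)%:R / t.1.1%:R, t.1.2%:R / t.1.1%:R).
set w : R := arc_eps R / N%:R; set h : R := arc_eps R / N%:R ^+ 2.
have w0 : 0 < w by rewrite divr_gt0.
have h0 : 0 < h by rewrite divr_gt0 ?exprn_gt0.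
have hE : h = w / N%:R by rewrite /h /w expr2 invfM mulrA.
have wN : w * N%:R = arc_eps R by rewrite /w divfK // gt_eqF.
have wQ : w * Q%:R ^+ 2 < 1 by nra.
have hw : h <= w by rewrite hE ler_pdivrMr // ler_peMr // ltW //; lra.
have wQ1 : w * Q%:R < 1 by nra.
have GP (t : T) : t \in A -> [/\ (0 < t.1.1 <= Q)%N, coprime t.1.2 t.1.1,
    xi.2 + Q%:R^-1 <= (p t).2 <= xi.2 + delta - Q%:R^-1 & Q%:R < 8 * t.1.1%:R :> R].
  rewrite !inE andbT => /andP[/and4P[t0 tc t1 t2] t8]; split => //.
  - by rewrite t0 -ltnS ltn_ord.
  - by rewrite t1.
  - by rewrite -natrM ltr_nat.
pose v : R := N%:R / (2 * Num.sqrt Q%:R).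
have sQ : 0 < Num.sqrt Q%:R :> R by rewrite sqrtr_gt0.
have v0 : 0 <= v by rewrite /v divr_ge0 // mulr_ge0 // ltW.
have vv : v ^+ 2 = N%:R ^+ 2 / (4 * Q%:R).
  by rewrite /v expr_div_n exprMn sqr_sqrtr //; congr (_ / (_ * _)); ring.
pose q (i : 'I_#|A|) := p (enum_val i).
have H := @I2_ge_rectangles R s delta xi N #|A| q w h v s0 w0 h0 v0.
apply: le_trans (H _ _ _ _); last first.
- move=> i t1 t2 ht1 ht2; have := GP _ (enum_valP i); rewrite /q.
  set t := enum_val i => -[/andP[t0 tQ] tc _ t8].
  have [ao _] := aP t.
  have tR0 : 0 < t.1.1%:R :> R by rewrite ltr0n.
  have tR : t.1.1%:R <= Q%:R :> R by rewrite ler_nat.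
  have st0 : 0 < Num.sqrt t.1.1%:R :> R by rewrite sqrtr_gt0.
  have stQ : Num.sqrt t.1.1%:R <= Num.sqrt Q%:R :> R by rewrite ler_wsqrtr.
  apply: (@le_trans _ _ (N%:R / (2 * Num.sqrt t.1.1%:R))).
    rewrite /v ler_pM2l // lef_pV2 ?posrE ?mulr_gt0 //; lra.
  apply: S2_near_rational => //.
  + rewrite -(ler_nat R) natrM; nra.
  (* The trivial bound q on the tail is enough: 8 q sqrt q <= 8 q^2 <= N, as 16 Q^2 <= N. *)
  + move=> r rt; apply: le_trans (normc_sum _ _ _) _.
    under eq_bigr do rewrite normc_rexp; rewrite sumr_const card_ord.
    apply: (@le_trans _ _ t.1.1%:R); first by rewrite ler_nat ltnW.
    rewrite ler_pdivlMr ?mulr_gt0 //.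
    have st2 : Num.sqrt t.1.1%:R ^+ 2 = t.1.1%:R :> R by rewrite sqr_sqrtr.
    have st1 : Num.sqrt t.1.1%:R <= t.1.1%:R :> R.
      have : 1 <= t.1.1%:R :> R by rewrite ler1n.
      nra.
    nra.
- move=> i j ij; have := GP _ (enum_valP j); have := GP _ (enum_valP i); rewrite /q.
  have : enum_val i != enum_val j by rewrite (inj_eq enum_val_inj).
  move: (enum_val i) (enum_val j) => t t' tt' [/andP[t0 tQ] tc _ _] [/andP[t'0 t'Q] tc' _ _].
  have tR0 : 0 < t.1.1%:R :> R by rewrite ltr0n.
  have tR : t.1.1%:R <= Q%:R :> R by rewrite ler_nat.
  have t'R0 : 0 < t'.1.1%:R :> R by rewrite ltr0n.
  have t'R : t'.1.1%:R <= Q%:R :> R by rewrite ler_nat.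
  (* For the same fraction a2/q, the points a1/q are at least 2/q apart, more than w. Different
     fractions are at least 1/Q^2 apart, more than h. *)
  have [e|ne] := eqVneq t.1 t'.1.
    left; have t2 : nat_of_ord t.2 != nat_of_ord t'.2.
      by apply: contraNneq tt' => /ord_inj e2; apply/eqP; case: t t' e e2 {t0 tQ tc tR0 tR t'0 t'Q tc' t'R0 t'R} => [? ?] [? ?] /= -> ->.
    rewrite /p /= /a e natrD [(_ + 2 * t'.2)%:R]natrD !natrM -mulrBl.
    rewrite normrM normfV (ger0_norm (ltW t'R0)) ltr_pdivlMr //.
    have -> : forall z : R, z + 2 * t.2%:R - (z + 2 * t'.2%:R) = 2 * (t.2%:R - t'.2%:R).
      by move=> z; ring.
    rewrite normrM ger0_norm //.
    have : 1 <= `|t.2%:R - t'.2%:R| :> R.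
      have [l|l|] := ltngtP t.2 t'.2; last by move=> e2; rewrite e2 eqxx in t2.
      - by rewrite distrC -natrB ?(ltnW l) // ger0_norm // ler1n subn_gt0.
      - by rewrite -natrB ?(ltnW l) // ger0_norm // ler1n subn_gt0.
    nra.
  right; have ne' : (nat_of_ord t.1.1, nat_of_ord t.1.2) != (nat_of_ord t'.1.1, nat_of_ord t'.1.2).
    apply: contraNneq ne => -[/ord_inj e1 /ord_inj e2]; apply/eqP.
    by move: (t.1) (t'.1) e1 e2 => [? ?] [? ?] /= -> ->.
  apply: lt_le_trans (reduced_fraction_gap R t0 t'0 tc tc' ne').
  rewrite -[h](@mulfK _ (t.1.1%:R * t'.1.1%:R)) ?mulf_neq0 ?gt_eqF //.
  rewrite -[X in _ < X]mul1r ltr_pM2r ?invr_gt0 ?mulr_gt0 //.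
  have tQ2 : t.1.1%:R * t'.1.1%:R <= Q%:R ^+ 2 :> R by rewrite expr2; apply: ler_pM.
  by apply: le_lt_trans wQ; apply: ler_pM => //; exact: ltW.
- move=> i; have := GP _ (enum_valP i); rewrite /q.
  set t := enum_val i => -[_ _ /andP[t1 t2] _].
  have hQ : h <= Q%:R^-1.
    rewrite -(ler_pM2r QR0) mulVf ?gt_eqF //; apply: le_trans (ltW wQ1).
    by rewrite ler_pM2r.
  have u0 : 0 < Q%:R^-1 :> R by rewrite invr_gt0.
  split; lra.
- move=> i; have := GP _ (enum_valP i); rewrite /q.
  set t := enum_val i => -[/andP[t0 tQ] _ _ t8].
  have tR0 : 0 < t.1.1%:R :> R by rewrite ltr0n.
  have tR : t.1.1%:R <= Q%:R :> R by rewrite ler_nat.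
  have [_ /andP[al au]] := aP t.
  split; first by rewrite /p /= ler_pdivlMr // mulrC.
  rewrite /p /= -(ler_pM2r tR0) mulrDl divfK ?gt_eqF //.
  have wt : w * t.1.1%:R <= w * Q%:R by rewrite ler_pM2l.
  have tM : t.2%:R + 1 <= M%:R :> R by rewrite natr1 ler_nat.
  have dt : delta * (Q%:R / 8) <= delta * t.1.1%:R by rewrite ler_pM2l //; lra.
  lra.
rewrite lee_fin powR2M // vv ler_wpM2l ?powR_ge0 // cardA natrM.
have -> : arc_eps R ^+ 2 / N%:R ^+ 3 = w * h by rewrite /w /h; field; rewrite gt_eqF.
apply: ler_wpM2r; first by apply: mulr_ge0; exact: ltW.
have -> : delta ^+ 2 * Q%:R ^+ 3 / 2048 = (delta * Q%:R ^+ 2 / 32) * (delta * Q%:R / 64) by field.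
by apply: ler_pM => //; rewrite divr_ge0 // mulr_ge0 ?sqr_ge0 // ltW.
Qed.

(** * The two lower bounds *)

Lemma powR_le1 (R : realType) (x e : R) : 1 <= x -> e <= 0 -> x `^ e <= 1.
Proof. by move=> x1 e0; have := ler_powR x1 e0; rewrite powRr0. Qed.

Lemma powR_ge1 (R : realType) (x e : R) : 1 <= x -> 0 <= e -> 1 <= x `^ e.
Proof. by move=> x1 e0; have := ler_powR x1 e0; rewrite powRr0. Qed.

Lemma I2flat_ge (R : realType) (s delta : R) (N : nat) (l : \bar R) :
  (forall xi : R * R, 0 <= xi.1 -> 0 <= xi.2 -> (l <= I2 s delta xi N)%E) ->
  (l <= I2flat s delta N)%E.
Proof.
move=> h; apply: le_ereal_inf_tmp => _ [xi [x1 x2] <-].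
by move: x1 x2; rewrite /= !in_itv /= => /andP[? _] /andP[? _]; exact: h.
Qed.

(** The constant 8 is what the mean square bound asks of delta N. For s <= 2 the maximum is 1, since
    delta N >= 1, and the mean square bound suffices. *)
Lemma I2flat_lower_bound1 (R : realType) (s : R) : 0 < s ->
  exists c : R, 0 < c /\
  exists N0 : nat, forall N : nat, (N0 <= N)%N ->
  forall delta : R, 8 / N%:R <= delta -> delta <= 1 ->
  ((c * (delta ^+ 2 * N%:R `^ (s - 1) * Num.max 1 ((delta * N%:R) `^ (s - 2))))%:E
    <= I2flat s delta N)%E.
Proof.
move=> s0.
have prep (N : nat) (delta : R) : (0 < N)%N -> 8 / N%:R <= delta ->
    [/\ 1 <= N%:R :> R, 0 < delta & 8 <= delta * N%:R].
  move=> N0; have NR : 0 < N%:R :> R by rewrite ltr0n.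
  move=> h; split; first by rewrite ler1n.
    by apply: lt_le_trans h; rewrite divr_gt0.
  by move: h; rewrite ler_pdivrMr.
have [s1|s1] := leP s 1.
  exists 16^-1; split; first by rewrite invr_gt0.
  exists 1%N => N /prep N0 delta /N0[NR d0 dN] d1; apply: I2flat_ge => xi _ _.
  apply: le_trans (I2_ge_mean_square_le1 xi s0 s1 d0 dN).
  rewrite lee_fin ler_wpM2l // ger_pMr ?mulr_gt0 ?exprn_gt0 ?powR_gt0 //; last by lra.
  by rewrite ge_max lexx /=; apply: powR_le1; lra.
have s1' : 1 <= s by exact: ltW.
pose cA : R := 8^-1 `^ (s - 1) / 16.
have cA0 : 0 < cA by rewrite divr_gt0 // powR_gt0 // invr_gt0.
(* For s > 1 the mean square bound gives N^s, a factor N above N^(s-1), which pays for a maximum of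
   size up to N. *)
have caseA (N : nat) (delta : R) : 1 <= N%:R :> R -> 0 < delta -> 8 <= delta * N%:R ->
    (delta * N%:R) `^ (s - 2) <= N%:R ->
    ((cA * (delta ^+ 2 * N%:R `^ (s - 1) * Num.max 1 ((delta * N%:R) `^ (s - 2))))%:E
    <= I2flat s delta N)%E.
  move=> NR d0 dN h; apply: I2flat_ge => xi _ _.
  apply: le_trans (I2_ge_mean_square_ge1 xi s1' d0 dN).
  have NR0 : 0 < N%:R :> R by lra.
  rewrite lee_fin (powR_subr1 s NR0); apply: ler_wpM2l; first exact: ltW.
  rewrite [leRHS]mulrA; apply: ler_wpM2l; last by rewrite ge_max NR.
  by rewrite mulr_ge0 ?sqr_ge0 ?powR_ge0.
have [s2|s2] := leP s 2.
  exists cA; split => //; exists 1%N => N /prep N0 delta /N0[NR d0 dN] d1.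
  apply: caseA => //; apply: le_trans NR.
  by apply: powR_le1; lra.
have e0 : 0 < s - 2 by lra.
(* If delta N < N^eta, then eta <= 1/(s-2) gives (delta N)^(s-2) <= N and [caseA] applies; otherwise
   the single major arc does. *)
pose eta := Num.min (s - 2)^-1 2^-1.
have eta0 : 0 < eta by rewrite /eta lt_min !invr_gt0 e0 ltr0n.
have eta1 : eta <= 2^-1 by rewrite /eta ge_min; apply/orP; right.
have eta2 : eta <= (s - 2)^-1 by rewrite /eta ge_min; apply/orP; left.
have [cB [cB0 [NB hB]]] := I2_ge_major_arc s0 eta0 eta1.
exists (Num.min cA cB); split; first by rewrite lt_min cA0.
exists (maxn 1 NB) => N; rewrite geq_max => /andP[/prep N0 hN] delta /N0[NR d0 dN] d1.
have NR0 : 0 < N%:R :> R by lra.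
have X0 : 0 <= delta ^+ 2 * N%:R `^ (s - 1) * Num.max 1 ((delta * N%:R) `^ (s - 2)).
  apply: mulr_ge0; last by rewrite le_max ler01.
  by apply: mulr_ge0; [exact: sqr_ge0 | exact: powR_ge0].
have [hl|hl] := leP (N%:R `^ eta) (delta * N%:R); last first.
  apply: le_trans (caseA N delta NR d0 dN _).
    by rewrite lee_fin ler_wpM2r // ge_min; apply/orP; left.
  apply: (@le_trans _ _ ((N%:R `^ eta) `^ (s - 2))).
    by apply: ge0_ler_powR; rewrite ?nnegrE ?powR_ge0 ?mulr_ge0 // ltW.
  rewrite -powRrM -[leRHS](powRr1 (ltW NR0)); apply: ler_powR => //.
  by rewrite -ler_pdivlMr // div1r.
apply: I2flat_ge => xi x1 x2; apply: le_trans (hB N hN delta xi x1 x2 hl d1).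
rewrite lee_fin; apply: (@le_trans _ _ (cB * (delta ^+ 2 * N%:R `^ (s - 1) * Num.max 1 ((delta * N%:R) `^ (s - 2))))).
  by rewrite ler_wpM2r // ge_min; apply/orP; right.
rewrite ler_wpM2l ?(ltW cB0) // max_r; last first.
  by apply: powR_ge1; lra.
rewrite powRM ?(ltW d0) //.
(* The two sides agree: delta^s N^(2s-3) = delta^2 N^(s-1) (delta N)^(s-2). *)
have -> : delta `^ s = delta ^+ 2 * delta `^ (s - 2).
  by rewrite -(powR_mulrn 2 (ltW d0)) -powRD_gt0 // addrC subrK.
have -> : 2 * s - 3 = (s - 1) + (s - 2) by ring.
rewrite (powRD_gt0 (s - 1) _ NR0).
by rewrite le_eqVlt; apply/orP; left; apply/eqP; ring.
Qed.

(** With Q the integer part of sqrt N / 4, at least sqrt N / 8, the constant 512 = 8 * 64 ensures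
    delta Q >= 64. *)
Lemma I2flat_lower_bound2 (R : realType) (s : R) : 0 < s ->
  exists c : R, 0 < c /\
  exists N0 : nat, forall N : nat, (N0 <= N)%N ->
  forall delta : R, 512 / Num.sqrt N%:R <= delta -> delta <= 1 ->
  ((c * (delta ^+ 2 * N%:R `^ (3 * (s - 1) / 2)))%:E <= I2flat s delta N)%E.
Proof.
move=> s0; pose c : R := arc_eps R ^+ 2 / 512 / 2048.
have c0 : 0 < c.
  apply: divr_gt0; last by rewrite ltr0n.
  apply: divr_gt0; last by rewrite ltr0n.
  by rewrite exprn_gt0 ?arc_eps_gt0.
exists c; split; first exact: c0.
exists 16%N => N N16 delta.
have NR : 16 <= N%:R :> R by rewrite ler_nat.
have NR0 : 0 < N%:R :> R by lra.
set r := Num.sqrt N%:R => dr d1.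
have r0 : 0 < r by rewrite sqrtr_gt0.
have r2 : r ^+ 2 = N%:R by rewrite sqr_sqrtr // ltW.
have r4 : 4 <= r by rewrite leNgt; apply/negP => ?; nra.
pose Q := Num.truncn (r / 4).
have r41 : 1 <= r / 4 by lra.
have Ql : r / 8 <= Q%:R by have := truncn_ge_half r41; rewrite -/Q; lra.
have Qu : 4 * Q%:R <= r.
  have r40 : 0 <= r / 4 by lra.
  by have /andP[] := truncn_itv r40; rewrite -/Q; lra.
have QR0 : 0 < Q%:R :> R by lra.
have Q0 : (0 < Q)%N by rewrite -(ltr_nat R).
have dr' : 512 <= delta * r by rewrite -ler_pdivrMr.
have d0 : 0 < delta by rewrite -(pmulr_lgt0 _ r0); lra.
have dQ : 64 <= delta * Q%:R.
  have := ler_wpM2l (ltW d0) Ql; lra.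
apply: I2flat_ge => xi x1 x2; apply: le_trans (I2_ge_many_arcs s0 x1 x2 Q0 Qu dQ).
(* W = N^(3/2) is the common scale: N^2/(4Q) >= W, Q^3 >= W/512 and N^3 = W^2, so the product is of
   order delta^2 W^(s-1). *)
rewrite lee_fin; pose W := r ^+ 3; have W0 : 0 < W by rewrite exprn_gt0.
have NW : N%:R `^ (3 * (s - 1) / 2) = W `^ (s - 1).
  have -> : 3 * (s - 1) / 2 = (3 / 2) * (s - 1) by field.
  rewrite powRrM; congr (_ `^ _); rewrite -r2 -powR2M ?(ltW r0) //.
  have -> : 2 * (3 / 2) = 3%:R :> R by field.
  by rewrite powR_mulrn // ltW.
have N3 : N%:R ^+ 3 = W ^+ 2 by rewrite -r2 /W -!exprM.
have h1 : W `^ s <= (N%:R ^+ 2 / (4 * Q%:R)) `^ s.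
  apply: ge0_ler_powR; rewrite ?nnegrE ?(ltW W0) ?(ltW s0) //.
  rewrite ler_pdivlMr ?mulr_gt0 // -r2 -exprM.
  have -> : r ^+ (2 * 2) = W * r by rewrite /W -exprSr.
  by rewrite ler_pM2l.
have h2 : W / 512 <= Q%:R ^+ 3.
  have -> : W / 512 = (r / 8) ^+ 3 by rewrite /W; field.
  apply: lerXn2r; rewrite ?nnegrE; lra.
rewrite NW N3; apply: (@le_trans _ _ (W `^ s *
    (delta ^+ 2 * (W / 512) / 2048 * (arc_eps R ^+ 2 / W ^+ 2)))).
  rewrite (powR_subr1 s W0) le_eqVlt; apply/orP; left; apply/eqP.
  by rewrite /c; field; rewrite gt_eqF.
have eW0 : 0 <= arc_eps R ^+ 2 / W ^+ 2 by apply: divr_ge0; exact: sqr_ge0.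
apply: ler_pM; [exact: powR_ge0 | | exact: h1 |].
  apply: mulr_ge0; last exact: eW0.
  apply: divr_ge0; last exact: ler0n.
  apply: mulr_ge0; first exact: sqr_ge0.
  by apply: divr_ge0; [exact: ltW | exact: ler0n].
apply: ler_wpM2r; first exact: eW0.
apply: ler_wpM2r; first by rewrite invr_ge0 ler0n.
by apply: ler_wpM2l; [exact: sqr_ge0 | exact: h2].
Qed.

Theorem theorem3p9 (R : realType) :
  (exists c1 : R, 0 < c1 /\
     forall s : R, 0 < s ->
     exists c : R, 0 < c /\
     exists N0 : nat, forall N : nat, (N0 <= N)%N ->
     forall delta : R, c1 / N%:R <= delta -> delta <= 1 ->
     ((c * (delta ^+ 2 * N%:R `^ (s - 1)
            * Num.max 1 ((delta * N%:R) `^ (s - 2))))%:E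
      <= I2flat s delta N)%E)
  /\
  (exists c2 : R, 0 < c2 /\
     forall s : R, 0 < s ->
     exists c : R, 0 < c /\
     exists N0 : nat, forall N : nat, (N0 <= N)%N ->
     forall delta : R, c2 / Num.sqrt N%:R <= delta -> delta <= 1 ->
     ((c * (delta ^+ 2 * N%:R `^ (3 * (s - 1) / 2)))%:E
      <= I2flat s delta N)%E).
Proof.
split.
  by exists 8; split; [rewrite ltr0n | exact: I2flat_lower_bound1].
by exists 512; split; [rewrite ltr0n | exact: I2flat_lower_bound2].
Qed.
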